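(* Let $\mathbf{P}$ be a random variable corresponding to the Haar probability measure $u_n$ on the orthogonal group $O(n)$. For fixed $\sigma\in\mathcal{W}_{2,ac}(\mathbb{R}^n)$ and $\mu\in\mathcal{W}_2(\mathbb{R}^n)$, we have $$\big\|S^{\sigma,\mu,W_2}-\mathbb{E}S^{\sigma,\mathcal{U}(\sigma,\mu,\mathbf{P}),W_2}\big\|_\sigma=\mathbb{E}\big\|S^{\sigma,\mu,W_2}-S^{\sigma,\mathcal{U}(\sigma,\mu,\mathbf{P}),W_2}\big\|_\sigma=\frac{W_2^2(\sigma,\mu)-n\,SW_2^2(\sigma,\mu)}{2\sqrt{M_2(\sigma)-\|E(\sigma)\|^2}}\ge0.$$
   Context: $\mathcal{W}_2(\mathbb{R}^n)$ is the set of probability measures $\sigma$ on $\mathbb{R}^n$ with finite second moment $M_2(\sigma)=\int\|x\|^2d\sigma(x)$, and $\mathcal{W}_{2,ac}(\mathbb{R}^n)$ is the subset of those absolutely continuous with respect to Lebesgue measure. $E(\sigma)=\int x\,d\sigma(x)$. $\sharp$ denotes pushforward. $W_2(\alpha,\beta)=\inf_\pi(\int\|x-y\|^2d\pi(x,y))^{1/2}$, the infimum being over couplings $\pi$ of $\alpha,\beta$. $\|F\|_\sigma=(\int\|F(x)\|^2d\sigma(x))^{1/2}$. For $\theta\in S^{n-1}$, $\sigma^\theta$ is the pushforward of $\sigma$ under $x\mapsto x\cdot\theta$. The sliced-Wasserstein distance is given by $SW_2^2(\sigma,\mu)=\int_{S^{n-1}}W_2^2(\sigma^\theta,\mu^\theta)\,du(\theta)$,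 with $u$ the uniform probability measure on $S^{n-1}$. For one-dimensional measures $\alpha$ (absolutely continuous) and $\beta$, $T_\alpha^\beta=F_\beta^{-1}\circ F_\alpha$ is the optimal transport map from $\alpha$ to $\beta$, where $F_\alpha$ is the cumulative distribution function of $\alpha$ and $F_\beta^{-1}$ is the pseudo-inverse of the cumulative distribution function of $\beta$. For $P=[\theta_1,\ldots,\theta_n]\in O(n)$ (columns $\theta_i$), $T_{\sigma,\mu;P}(x)=\sum_{i=1}^nT_{\sigma^{\theta_i}}^{\mu^{\theta_i}}(x\cdot\theta_i)\,\theta_i$ and $\mathcal{U}(\sigma,\mu,P)=(T_{\sigma,\mu;P})_\sharp\sigma$. For $\eta=\mu$ or $\eta=\mathcal{U}(\sigma,\mu,P)$, $S^{\sigma,\eta,W_2}:=\operatorname*{arg\,min}_{S\in\mathcal{S}}W_2(S_\sharp\sigma,\eta)$, where $\mathcal{S}=\{S(x)=ax+b\mid a>0,\ b\in\mathbb{R}^n\}$. $\mathbb{E}$ denotes expectation over $\mathbf{P}$; for the map-valued random variable $S^{\sigma,\mathcal{U}(\sigma,\mu,\mathbf{P}),W_2}$ it is taken pointwise. *)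

(* Defs.v *)
From HB Require Import structures.
From mathcomp Require Import all_boot all_order all_algebra.
From mathcomp Require Import all_classical all_reals all_analysis.
Set Implicit Arguments.
Unset Strict Implicit.
Unset Printing Implicit Defensive.
Import Order.TTheory GRing.Theory Num.Theory.
Import numFieldNormedType.Exports.
Local Open Scope classical_set_scope.
Local Open Scope ring_scope.

(* The product sigma-algebra on matrices, generated by the entries, exactly as
   the library does for tuples. For 'cV[R]_n and 'M[R]_n over the reals it is
   the Borel sigma-algebra of R^n and R^(n x n). *)
Definition measure_matrix_display : measure_display -> measure_display.
Proof. exact. Qed.

Section measurable_matrix.
Context {d} {T : measurableType d} (m n : nat).

Definition matrix_measurable : set (set 'M[T]_(m, n)) :=
  <<s \bigcup_(ij in [set: 'I_m * 'I_n])
        preimage_set_system setT (fun M : 'M[T]_(m, n) => M ij.1 ij.2)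
          measurable >>.

Let matrix_set0 : matrix_measurable set0.
Proof. exact: sigma_algebra0. Qed.

Let matrix_setC A : matrix_measurable A -> matrix_measurable (~` A).
Proof. exact: sigma_algebraC. Qed.

Let matrix_bigcup (F : (set 'M[T]_(m, n))^nat) :
  (forall i, matrix_measurable (F i)) -> matrix_measurable (\bigcup_i F i).
Proof. exact: sigma_algebra_bigcup. Qed.

HB.instance Definition _ := @isMeasurable.Build (measure_matrix_display d)
  'M[T]_(m, n) matrix_measurable matrix_set0 matrix_setC matrix_bigcup.

End measurable_matrix.

Section euclidean.
Context {R : realType}.

Definition dot {n} (x y : 'cV[R]_n) : R := \sum_(i < n) x i 0 * y i 0.

(* Not `|x|, which in the library is the sup norm on matrices. *)
Definition enorm {n} (x : 'cV[R]_n) : R := Num.sqrt (dot x x).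

Definition unit_sphere n : set 'cV[R]_n := [set x | enorm x = 1].

Definition orthogonal_group n : set 'M[R]_n := [set Q | Q^T *m Q = 1%:M].

End euclidean.
Arguments unit_sphere {R} n.
Arguments orthogonal_group {R} n.

Section measures.
Context {R : realType}.
Local Open Scope ereal_scope.

(* Lebesgue measure on R^n as the iterated product measure: lambda_(n+1) is
   the product of lambda_1 and lambda_n, written out as in product_measure1,
   and lambda_0 is the unit mass at the only point of R^0. *)
Fixpoint lebesgue_cV (n : nat) : set 'cV[R]_n -> \bar R :=
  match n with
  | 0%N => fun A => dirac (0%R : 'cV[R]_0) A
  | n'.+1 => fun A => \int[lebesgue_measure]_t
      lebesgue_cV [set y : 'cV[R]_n' | A (col_mx (t%:M : 'cV[R]_1) y)]
  end.

(* Normalised left Haar measure of O(n), as a measure on all matrices that is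
   concentrated on O(n). *)
Definition haar_orthogonal n (m : probability 'M[R]_n R) : Prop :=
  m (orthogonal_group n) = 1 /\
  forall (Q : 'M[R]_n) (A : set 'M[R]_n), orthogonal_group n Q ->
    measurable A -> pushforward m (mulmx Q) A = m A.

(* The rotation-invariant probability measure on S^(n-1), as a measure on R^n
   that is concentrated on the sphere. *)
Definition uniform_sphere n (m : probability 'cV[R]_n R) : Prop :=
  m (unit_sphere n) = 1 /\
  forall (Q : 'M[R]_n) (A : set 'cV[R]_n), orthogonal_group n Q ->
    measurable A -> pushforward m (mulmx Q) A = m A.

Definition second_moment n (sigma : probability 'cV[R]_n R) : \bar R :=
  \int[sigma]_x ((enorm x) ^+ 2)%:E.

Definition W2_space n (sigma : probability 'cV[R]_n R) : Prop :=
  second_moment sigma < +oo.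

Definition W2ac_space n (sigma : probability 'cV[R]_n R) : Prop :=
  W2_space sigma /\ sigma `<< @lebesgue_cV n.

Definition vmean d (T : measurableType d) (m : probability T R) n
    (X : T -> 'cV[R]_n) : 'cV[R]_n :=
  \col_(i < n) (\int[m]_t X t i 0)%R.

Definition L2norm n (sigma : probability 'cV[R]_n R)
    (F : 'cV[R]_n -> 'cV[R]_n) : \bar R :=
  'N[sigma]_2%:E [(fun x => (enorm (F x))%:E)].

End measures.

Section wasserstein.
Context {R : realType}.
Local Open Scope ereal_scope.

(* Measures are taken as set functions so that pushforwards by maps whose
   measurability is not recorded in their type are accepted. *)
Definition couplings d (T : measurableType d) (alpha beta : set T -> \bar R) :
    set (probability (T * T)%type R) :=
  [set gamma : probability (T * T)%type R | forall A : set T, measurable A ->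
     pushforward gamma fst A = alpha A /\ pushforward gamma snd A = beta A].

Definition W2_dist d (T : measurableType d) (dist : T -> T -> R)
    (alpha beta : set T -> \bar R) : \bar R :=
  ereal_inf [set 'N[gamma]_2%:E [(fun z => (dist z.1 z.2)%:E)] |
             gamma in couplings alpha beta].

Definition W2 n (alpha beta : set 'cV[R]_n -> \bar R) : \bar R :=
  W2_dist (fun x y : 'cV[R]_n => enorm (x - y)%R) alpha beta.

Definition W2_1d (alpha beta : set (measurableTypeR R) -> \bar R) : \bar R :=
  W2_dist (fun x y : measurableTypeR R => `|x - y|%R) alpha beta.

Definition slice n (sigma : set 'cV[R]_n -> \bar R) (theta : 'cV[R]_n) :
    set (measurableTypeR R) -> \bar R :=
  pushforward sigma (fun x => dot x theta).

Definition SW2_sqr n (u : probability 'cV[R]_n R)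
    (sigma mu : set 'cV[R]_n -> \bar R) : \bar R :=
  \int[u]_(theta in unit_sphere n)
    (W2_1d (slice sigma theta) (slice mu theta)) ^+ 2.

Definition cdf_of (alpha : set (measurableTypeR R) -> \bar R) (r : R) : \bar R :=
  alpha `]-oo, r]%classic.

(* Outside 0 < t < 1 the infimum may be over the whole line or over the empty
   set, where inf is 0 by convention; t = F_alpha(x) lies there only for x in a
   null set of alpha. *)
Definition quantile (beta : set (measurableTypeR R) -> \bar R) (t : \bar R) : R :=
  inf [set x | t <= cdf_of beta x].

Definition ot_map_1d (alpha beta : set (measurableTypeR R) -> \bar R) : R -> R :=
  quantile beta \o cdf_of alpha.

Definition slice_matching_map n (sigma mu : set 'cV[R]_n -> \bar R)
    (P : 'M[R]_n) (x : 'cV[R]_n) : 'cV[R]_n :=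
  (\sum_(i < n) ot_map_1d (slice sigma (col i P)) (slice mu (col i P))
                  (dot x (col i P)) *: col i P)%R.

Definition slice_matching n (sigma mu : set 'cV[R]_n -> \bar R)
    (P : 'M[R]_n) : set 'cV[R]_n -> \bar R :=
  pushforward sigma (slice_matching_map sigma mu P).

Definition scale_translations n : set ('cV[R]_n -> 'cV[R]_n) :=
  [set S | exists a b, (0 < a)%R /\ S = (fun x => a *: x + b)%R].

Definition argmin_W2 n (sigma eta : set 'cV[R]_n -> \bar R) :
    set ('cV[R]_n -> 'cV[R]_n) :=
  [set S | scale_translations S /\
     forall S', scale_translations S' ->
       W2 (pushforward sigma S) eta <= W2 (pushforward sigma S') eta].

(* The element of argmin_W2. If eta is a Dirac mass no a > 0 is optimal, and
   the default value id is returned; this is the case for eta = mu exactly when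
   it is for eta = slice_matching sigma mu P. *)
Definition opt_S n (sigma eta : set 'cV[R]_n -> \bar R) : 'cV[R]_n -> 'cV[R]_n :=
  xget (id : 'cV[R]_n -> 'cV[R]_n) (argmin_W2 sigma eta).

End wasserstein.

(* Main.v *)
(* Expanding the square in the transport cost, a scale-translation of sigma is
   optimal for a target eta when it maps E(sigma) to E(eta) and its slope is
   c(eta) / Var(sigma), where c(eta) is the largest covariance of a coupling of
   sigma and eta. The target U(sigma, mu, P) has the mean of mu, and c(U) is
   the sum of the optimal covariances of the slices along the columns of P: this
   sum bounds the covariance of any coupling with these slices, and the slice
   matching map attains it. Hence c(mu) <= c(U), the optimal maps differ by a
   nonnegative multiple of x - E(sigma), and the norm of the difference is
   linear in c(U), so that it commutes with the expectation. Finally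
   c(U) - c(mu) is half of W_2^2(sigma, mu) minus the sum of the squared
   distances of the slices, and each column of P is uniform on the sphere.
   When c(mu) = 0 no slope is optimal; perturbing the product coupling shows
   that mu is then a Dirac mass, so that c(U) = 0 as well. *)

Require Import Defs.
From HB Require Import structures.
From mathcomp Require Import all_boot all_order all_algebra.
From mathcomp Require Import all_classical all_reals all_analysis.
From mathcomp Require Import measurable_realfun ring lra.
Set Implicit Arguments.
Unset Strict Implicit.
Unset Printing Implicit Defensive.
Import Order.TTheory GRing.Theory Num.Theory.
Import numFieldNormedType.Exports.
Local Open Scope classical_set_scope.
Local Open Scope ring_scope.

(** * Square-integrable functions and laws *)

(** In dimension n no optimal coupling of [sigma] and [mu] is constructed: all couplings share every
    term of the cost but the correlation, so [W2] is computed from a supremum of correlations.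
    Explicit optimisers are needed for the slices only. There the optimality of the quantile
    coupling rests on the layer-cake formula, which turns E[XY] into an integral of joint tails, and
    on the fact that a comonotone pair has the largest joint tails its marginals allow. Absolute
    continuity enters through the nullity of hyperplanes, which yields atomless slices, a positive
    variance of [sigma], and the contradiction in the degenerate case. Two obstacles shape the rest.
    The conventional values of [quantile] need not depend measurably on the direction, so they are
    replaced by 0 on a null set before integrating over the sphere. And [u] is given by its
    invariance alone, so identifying it with the law of a column of [P] amounts to the uniqueness of
    the rotation-invariant probability on the sphere. *)

Section integrals.
Context d (T : measurableType d) {R : realType} (m : probability T R).
Implicit Types f g : T -> R.

Definition rintegrable f := m.-integrable setT (EFin \o f).

Definition sqintegrable f :=
  measurable_fun setT f /\ rintegrable (fun x => f x ^+ 2).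

Lemma rintegrable_measurable f : rintegrable f -> measurable_fun setT f.
Proof. by move=> /integrableP[/measurable_EFinP]. Qed.

Lemma le_rintegrable f g : measurable_fun setT f ->
  (forall x, `|f x| <= g x) -> rintegrable g -> rintegrable f.
Proof.
move=> mf fg ig; apply: le_integrable ig => //=; first exact/measurable_EFinP.
by move=> x _; rewrite lee_fin (le_trans (fg x))// ler_norm.
Qed.

Lemma rintegrableD f g : rintegrable f -> rintegrable g ->
  rintegrable (fun x => f x + g x).
Proof. by move=> i j; have := integrableD measurableT i j. Qed.

Lemma rintegrableZ k f : rintegrable f -> rintegrable (fun x => k * f x).
Proof. by move=> i; have := integrableZl measurableT k i. Qed.

Lemma rintegrableN f : rintegrable f -> rintegrable (fun x => - f x).
Proof. by move=> i; have := integrableN i. Qed.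

Lemma rintegrableB f g : rintegrable f -> rintegrable g ->
  rintegrable (fun x => f x - g x).
Proof. by move=> i j; apply: rintegrableD => //; exact: rintegrableN. Qed.

Lemma rintegrable_cst k : rintegrable (fun=> k).
Proof. exact: finite_measure_integrable_cst. Qed.

Lemma rintegrable_sum n (F : 'I_n -> T -> R) : (forall i, rintegrable (F i)) ->
  rintegrable (fun x => \sum_(i < n) F i x).
Proof.
move=> iF; rewrite /rintegrable.
have -> : EFin \o (fun x => \sum_(i < n) F i x) =
    (fun x => \sum_(i < n) (EFin \o F i) x)%E.
  by apply/funext => x /=; rewrite sumEFin.
exact: (@integrable_sum _ _ _ m setT measurableT 'I_n (index_enum _) xpredT
  (fun i => EFin \o F i) (fun i _ => iF i)).
Qed.

Lemma EFin_Rintegral f : rintegrable f ->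
  (\int[m]_x (f x)%:E)%E = (\int[m]_x f x)%:E.
Proof. by move=> i; rewrite fineK//; exact: (integrable_fin_num measurableT i). Qed.

Lemma Rintegral_cst1 (k : R) : \int[m]_x k = k.
Proof. by rewrite Rintegral_cst// [X in fine X]probability_setT mulr1. Qed.

Lemma Rintegral_add f g : rintegrable f -> rintegrable g ->
  \int[m]_x (f x + g x) = \int[m]_x f x + \int[m]_x g x.
Proof. by move=> i j; rewrite RintegralD. Qed.

Lemma Rintegral_sub f g : rintegrable f -> rintegrable g ->
  \int[m]_x (f x - g x) = \int[m]_x f x - \int[m]_x g x.
Proof. by move=> i j; rewrite RintegralB. Qed.

Lemma Rintegral_scale k f : rintegrable f ->
  \int[m]_x (k * f x) = k * \int[m]_x f x.
Proof. by move=> i; rewrite RintegralZl. Qed.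

Lemma Rintegral_sum n (F : 'I_n -> T -> R) : (forall i, rintegrable (F i)) ->
  \int[m]_x (\sum_(i < n) F i x) = \sum_(i < n) \int[m]_x F i x.
Proof.
elim: n F => [|n IH] F iF.
  under eq_Rintegral do rewrite big_ord0.
  by rewrite big_ord0 Rintegral_cst1.
under eq_Rintegral do rewrite big_ord_recl.
rewrite Rintegral_add//; last exact: rintegrable_sum.
by rewrite big_ord_recl IH.
Qed.

Lemma Rintegral_le f g : rintegrable f -> rintegrable g ->
  (forall x, f x <= g x) -> \int[m]_x f x <= \int[m]_x g x.
Proof. by move=> i j fg; apply: le_Rintegral. Qed.

Lemma ge0_rintegrable f : measurable_fun setT f -> (forall x, 0 <= f x) ->
  (\int[m]_x (f x)%:E < +oo)%E -> rintegrable f.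
Proof.
move=> mf f0 foo; apply/integrableP; split; first exact/measurable_EFinP.
by under eq_integral do rewrite /= ger0_norm//.
Qed.

Lemma sqintegrable_mul f g : sqintegrable f -> sqintegrable g ->
  rintegrable (fun x => f x * g x).
Proof.
move=> [mf f2] [mg g2].
apply: (@le_rintegrable _ (fun x => f x ^+ 2 + g x ^+ 2)).
- exact: measurable_funM.
- move=> x; rewrite normrM -(real_normK (num_real (f x))).
  rewrite -(real_normK (num_real (g x))).
  move: `|f x| `|g x| (normr_ge0 (f x)) (normr_ge0 (g x)) => a b a0 b0.
  by have := sqr_ge0 (a - b); nra.
- exact: rintegrableD.
Qed.

Lemma sqintegrable_cst k : sqintegrable (fun=> k).
Proof. by split; [exact: measurable_cst|exact: rintegrable_cst]. Qed.

Lemma sqintegrable_rintegrable f : sqintegrable f -> rintegrable f.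
Proof.
move=> /(sqintegrable_mul (sqintegrable_cst 1)).
by under [X in rintegrable X]eq_fun do rewrite mul1r.
Qed.

Lemma sqintegrableZ k f : sqintegrable f -> sqintegrable (fun x => k * f x).
Proof.
move=> [mf f2]; split; first by apply: measurable_funM => //; exact: measurable_cst.
under [X in rintegrable X]eq_fun do rewrite exprMn.
exact: rintegrableZ.
Qed.

Lemma sqintegrableD f g : sqintegrable f -> sqintegrable g ->
  sqintegrable (fun x => f x + g x).
Proof.
move=> f2 g2; split; first by apply: measurable_funD; [case: f2|case: g2].
have -> : (fun x => (f x + g x) ^+ 2) =
  (fun x => f x ^+ 2 + g x ^+ 2 + 2 * (f x * g x)) by apply/funext => x; ring.
apply: rintegrableD; first by apply: rintegrableD; [case: f2|case: g2].
by apply: rintegrableZ; exact: sqintegrable_mul.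
Qed.

Lemma sqintegrableB f g : sqintegrable f -> sqintegrable g ->
  sqintegrable (fun x => f x - g x).
Proof.
move=> f2 g2; apply: sqintegrableD => //.
under [X in sqintegrable X]eq_fun do rewrite -mulN1r.
exact: sqintegrableZ.
Qed.

Lemma sqintegrable_sum n (F : 'I_n -> T -> R) : (forall i, sqintegrable (F i)) ->
  sqintegrable (fun x => \sum_(i < n) F i x).
Proof.
elim: n F => [|n IH] F iF.
  under [X in sqintegrable X]eq_fun do rewrite big_ord0.
  exact: sqintegrable_cst.
under [X in sqintegrable X]eq_fun do rewrite big_ord_recl.
by apply: sqintegrableD => //; exact: IH.
Qed.

Lemma le_sqintegrable f g : measurable_fun setT f ->
  (forall x, `|f x| <= `|g x|) -> sqintegrable g -> sqintegrable f.
Proof.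
move=> mf fg [mg g2]; split => //; apply: le_rintegrable g2.
  exact: measurable_funX.
move=> x; rewrite normrX -(real_normK (num_real (g x))).
by rewrite lerXn2r// nnegrE.
Qed.

Lemma ae_eq_Rintegral f g (N : set T) : measurable_fun setT f ->
  measurable_fun setT g -> measurable N -> m N = 0%E ->
  (forall x, ~ N x -> f x = g x) -> \int[m]_x f x = \int[m]_x g x.
Proof.
move=> mf mg mN N0 fg; congr fine; apply: ae_eq_integral => //.
- exact/measurable_EFinP.
- exact/measurable_EFinP.
- exists N; split => // x /=; apply: contra_notP => Nx _ /=.
  by rewrite fg.
Qed.

End integrals.

Section laws.
Context d (T : measurableType d) d' (T' : measurableType d') {R : realType}.
Context (m : probability T R) (X : T -> T') (m' : probability T' R).

(** The law [m'] is a given probability rather than the pushforward itself, so that marginals of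
    couplings, distributions and [u] are treated alike. *)
Definition is_law := measurable_fun setT X /\
  forall A : set T', measurable A -> pushforward m X A = m' A.

Hypothesis lawX : is_law.

Lemma law_ge0_integral (f : T' -> \bar R) : measurable_fun setT f ->
  (forall y, 0 <= f y)%E -> (\int[m']_y f y = \int[m]_x f (X x))%E.
Proof.
move=> mf f0; have [mX lX] := lawX.
rewrite -[RHS](@ge0_integral_pushforward _ _ _ _ _ _ mX m setT f)//.
by apply: eq_measure_integral => A mA _; exact: (esym (lX A mA)).
Qed.

Lemma law_rintegrable (f : T' -> R) : rintegrable m' f ->
  rintegrable m (fun x => f (X x)).
Proof.
move=> /integrableP[mf foo]; have [mX _] := lawX; apply/integrableP; split.
  exact: (measurableT_comp mf).
rewrite -(@law_ge0_integral (fun y => `|(f y)%:E|)%E)//.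
exact: measurableT_comp.
Qed.

Lemma rintegrable_law (f : T' -> R) : measurable_fun setT f ->
  rintegrable m (fun x => f (X x)) -> rintegrable m' f.
Proof.
move=> mf /integrableP[_ foo]; apply/integrableP; split; first exact/measurable_EFinP.
rewrite (@law_ge0_integral (fun y => `|(f y)%:E|)%E)//.
by apply: measurableT_comp => //; exact/measurable_EFinP.
Qed.

Lemma sqintegrable_law (f : T' -> R) : measurable_fun setT f ->
  sqintegrable m (fun x => f (X x)) -> sqintegrable m' f.
Proof.
move=> mf [_ f2]; split => //; apply: rintegrable_law => //.
exact: measurable_funX.
Qed.

Lemma law_Rintegral (f : T' -> R) : rintegrable m' f ->
  \int[m']_y f y = \int[m]_x f (X x).
Proof.
move=> fi; have [mX lX] := lawX; congr fine.
rewrite -[RHS](@integral_pushforward _ _ _ _ _ _ mX m setT (EFin \o f))//.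
- by apply: eq_measure_integral => A mA _; exact: (esym (lX A mA)).
- exact: measurable_int fi.
- by rewrite preimage_setT; exact: law_rintegrable.
Qed.

Lemma law_sqintegrable (f : T' -> R) : sqintegrable m' f ->
  sqintegrable m (fun x => f (X x)).
Proof.
move=> [mf f2]; split; first by apply: measurableT_comp => //; case: lawX.
exact: (law_rintegrable f2).
Qed.

End laws.

(** * Euclidean space *)

Section matrix_measurability.
Context d (T : measurableType d) {R : realType}.

Lemma measurable_mx_entry p q (i : 'I_p) (j : 'I_q) :
  measurable_fun setT (fun M : 'M[R]_(p, q) => M i j).
Proof.
move=> _ Y mY; rewrite setTI; apply: sub_sigma_algebra.
exists (i, j) => //; exists Y => //.
by rewrite setTI.
Qed.

Lemma measurable_mx p q (f : T -> 'M[R]_(p, q)) :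
  (forall i j, measurable_fun setT (fun t => f t i j)) -> measurable_fun setT f.
Proof.
move=> mf; apply: (@measurability _ _ _ _ _ _
  (\bigcup_(ij in [set: 'I_p * 'I_q])
     preimage_set_system setT (fun M : 'M[R]_(p, q) => M ij.1 ij.2) measurable)) => //.
move=> _ [_ [[i j] _ [Y mY <-]] <-] /=.
have := mf i j measurableT Y mY.
by rewrite !setTI.
Qed.

Lemma measurable_entry_comp p q (f : T -> 'M[R]_(p, q)) i j :
  measurable_fun setT f -> measurable_fun setT (fun t => f t i j).
Proof. exact: (measurableT_comp (measurable_mx_entry i j)). Qed.

Lemma measurable_Rsum n (F : 'I_n -> T -> R) : (forall i, measurable_fun setT (F i)) ->
  measurable_fun setT (fun x => \sum_(i < n) F i x).
Proof. by move=> mF; apply: measurable_sum => i; exact: mF. Qed.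

Lemma measurable_dot n (f g : T -> 'cV[R]_n) : measurable_fun setT f ->
  measurable_fun setT g -> measurable_fun setT (fun t => dot (f t) (g t)).
Proof.
move=> mf mg; apply: measurable_Rsum => i.
by apply: measurable_funM; exact: measurable_entry_comp.
Qed.

Lemma measurable_mulmx p q r (f : T -> 'M[R]_(p, q)) (g : T -> 'M[R]_(q, r)) :
  measurable_fun setT f -> measurable_fun setT g ->
  measurable_fun setT (fun t => f t *m g t).
Proof.
move=> mf mg; apply: measurable_mx => i j.
under eq_fun do rewrite mxE.
apply: measurable_Rsum => k.
by apply: measurable_funM; exact: measurable_entry_comp.
Qed.

Lemma measurable_trmx p q (f : T -> 'M[R]_(p, q)) :
  measurable_fun setT f -> measurable_fun setT (fun t => (f t)^T).
Proof.
move=> mf; apply: measurable_mx => i j.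
by under eq_fun do rewrite mxE; exact: measurable_entry_comp.
Qed.

Lemma measurable_col p q (f : T -> 'M[R]_(p, q)) j :
  measurable_fun setT f -> measurable_fun setT (fun t => col j (f t)).
Proof.
move=> mf; apply: measurable_mx => i k.
by under eq_fun do rewrite mxE; exact: measurable_entry_comp.
Qed.

Lemma measurable_scale_mx p q (k : T -> R) (f : T -> 'M[R]_(p, q)) :
  measurable_fun setT k -> measurable_fun setT f ->
  measurable_fun setT (fun t => k t *: f t).
Proof.
move=> mk mf; apply: measurable_mx => i j.
under eq_fun do rewrite mxE.
by apply: measurable_funM => //; exact: measurable_entry_comp.
Qed.

Lemma measurable_add_mx p q (f g : T -> 'M[R]_(p, q)) :
  measurable_fun setT f -> measurable_fun setT g ->
  measurable_fun setT (fun t => f t + g t).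
Proof.
move=> mf mg; apply: measurable_mx => i j.
under eq_fun do rewrite mxE.
by apply: measurable_funD; exact: measurable_entry_comp.
Qed.

Lemma measurable_sub_mx p q (f g : T -> 'M[R]_(p, q)) :
  measurable_fun setT f -> measurable_fun setT g ->
  measurable_fun setT (fun t => f t - g t).
Proof.
move=> mf mg; apply: measurable_mx => i j.
under eq_fun do rewrite !mxE.
by apply: measurable_funB; exact: measurable_entry_comp.
Qed.

Lemma measurable_enorm n (f : T -> 'cV[R]_n) : measurable_fun setT f ->
  measurable_fun setT (fun t => enorm (f t)).
Proof.
move=> mf; apply: (@measurableT_comp _ _ _ _ _ _ (@Num.sqrt R)).
  by apply: continuous_measurable_fun; exact: sqrt_continuous.
exact: measurable_dot.
Qed.

Lemma measurable_sum_mx n p q (F : 'I_n -> T -> 'M[R]_(p, q)) :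
  (forall i, measurable_fun setT (F i)) ->
  measurable_fun setT (fun t => \sum_(i < n) F i t).
Proof.
move=> mF; apply: measurable_mx => i j.
under eq_fun do rewrite summxE.
by apply: measurable_Rsum => k; exact: measurable_entry_comp.
Qed.

End matrix_measurability.

Section dot_product.
Context {R : realType} {n : nat}.
Implicit Types x y z : 'cV[R]_n.

Lemma dotC x y : dot x y = dot y x.
Proof. by apply: eq_bigr => i _; rewrite mulrC. Qed.

Lemma dotDl x y z : dot (x + y) z = dot x z + dot y z.
Proof. by rewrite -big_split; apply: eq_bigr => i _; rewrite mxE mulrDl. Qed.

Lemma dotDr x y z : dot x (y + z) = dot x y + dot x z.
Proof. by rewrite dotC dotDl !(dotC x). Qed.

Lemma dotZl k x y : dot (k *: x) y = k * dot x y.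
Proof. by rewrite mulr_sumr; apply: eq_bigr => i _; rewrite mxE mulrA. Qed.

Lemma dotZr k x y : dot x (k *: y) = k * dot x y.
Proof. by rewrite dotC dotZl dotC. Qed.

Lemma dot0l x : dot 0 x = 0.
Proof. by rewrite -(scale0r (0 : 'cV[R]_n)) dotZl mul0r. Qed.

Lemma dotNl x y : dot (- x) y = - dot x y.
Proof. by rewrite -scaleN1r dotZl mulN1r. Qed.

Lemma dotNr x y : dot x (- y) = - dot x y.
Proof. by rewrite dotC dotNl dotC. Qed.

Lemma dotBl x y z : dot (x - y) z = dot x z - dot y z.
Proof. by rewrite dotDl dotNl. Qed.

Lemma dotBr x y z : dot x (y - z) = dot x y - dot x z.
Proof. by rewrite dotDr dotNr. Qed.

Lemma dot_ge0 x : 0 <= dot x x.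
Proof. by apply: sumr_ge0 => i _; rewrite -expr2 sqr_ge0. Qed.

Lemma enorm_sqr x : enorm x ^+ 2 = dot x x.
Proof. by rewrite sqr_sqrtr// dot_ge0. Qed.

Lemma enormB_sqr x y : enorm (x - y) ^+ 2 = dot x x + dot y y - 2 * dot x y.
Proof. by rewrite enorm_sqr dotBl !dotBr (dotC y x); ring. Qed.

Lemma dot_eq0 x : (dot x x == 0) = (x == 0).
Proof.
apply/eqP/eqP => [|->]; last by rewrite /dot big1// => i _; rewrite mxE mul0r.
move/eqP; rewrite psumr_eq0; last by move=> i _; rewrite -expr2 sqr_ge0.
move=> /allP h; apply/colP => i; have := h i (mem_index_enum i).
by rewrite mulf_eq0 orbb mxE => /eqP.
Qed.

Lemma dot_mx x y : dot x y = (x^T *m y) 0 0.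
Proof. by rewrite mxE; apply: eq_bigr => i _; rewrite mxE. Qed.

Lemma dot_mulmx (Q : 'M[R]_n) x y : dot (Q *m x) y = dot x (Q^T *m y).
Proof. by rewrite !dot_mx trmx_mul mulmxA. Qed.

Lemma dot_coord (Q : 'M[R]_n) x i : dot x (col i Q) = (Q^T *m x) i 0.
Proof. by rewrite mxE; apply: eq_bigr => j _; rewrite !mxE mulrC. Qed.

Lemma dot_delta x i : dot x (delta_mx i 0) = x i 0.
Proof.
rewrite /dot (bigD1 i)//= big1 ?addr0 => [|j ji].
  by rewrite mxE !eqxx mulr1.
by rewrite mxE (negPf ji) mulr0.
Qed.

Lemma orthogonal_tr (Q : 'M[R]_n) : orthogonal_group n Q -> Q *m Q^T = 1%:M.
Proof. exact: mulmx1C. Qed.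

(** Parseval's identity: [Q^T] preserves the product, and its action on a vector lists the products
    with the columns of [Q]. *)
Lemma dot_orthogonal (Q : 'M[R]_n) x y : orthogonal_group n Q ->
  dot x y = \sum_(i < n) dot x (col i Q) * dot y (col i Q).
Proof.
move=> /orthogonal_tr oQ; transitivity (dot (Q^T *m x) (Q^T *m y)).
  by rewrite dot_mulmx trmxK mulmxA oQ mul1mx.
by apply: eq_bigr => i _; rewrite !dot_coord.
Qed.

Lemma col_orthogonal (Q : 'M[R]_n) i : orthogonal_group n Q ->
  unit_sphere n (col i Q).
Proof.
rewrite /orthogonal_group /unit_sphere /= /enorm => oQ.
rewrite dot_coord colE mulmxA oQ mul1mx.
by rewrite !mxE eqxx /= sqrtr1.
Qed.

End dot_product.

(** * Optimality of comonotone couplings *)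

Section layer_cake.
Context d (T : measurableType d) {R : realType} (m : probability T R).
Let GR := measurableTypeR R.
Let leb : {sigma_finite_measure set GR -> \bar R} := @lebesgue_measure R.

(** Supported on t >= 0 but defined for all t, so that levels range over the whole line with
    Lebesgue measure and negative ones contribute nothing. *)
Definition layer (t x : R) : R := \1_`[0, x[%classic t.

Lemma layer_ge0 t x : 0 <= layer t x. Proof. by []. Qed.

Lemma integral_layer x : 0 <= x -> (\int[leb]_t (layer t x)%:E = x%:E)%E.
Proof.
move=> x0; rewrite integral_indic//= setIT lebesgue_measure_itv/= lte_fin.
by move: x0; rewrite le_eqVlt => /predU1P[<-|x0]; rewrite ?ltxx ?x0 ?sube0.
Qed.

Lemma measurable_layer d' (T' : measurableType d') (f g : T' -> R) :
  measurable_fun setT f -> measurable_fun setT g ->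
  measurable_fun setT (fun z => layer (g z) (f z)).
Proof.
move=> mf mg.
have -> : (fun z => layer (g z) (f z)) =
    \1_((fun z => 0 <= g z) @^-1` [set true] `&`
        (fun z => g z < f z) @^-1` [set true]).
  apply/funext => z; rewrite /layer !indicE; congr (_%:R).
  apply: congr1; apply/idP/idP; rewrite !inE /= in_itv /=.
    by move=> /andP[].
  by move=> [h1 h2]; apply/andP; split.
apply: measurable_indic; apply: measurableI; rewrite -[X in measurable X]setTI.
  by apply: measurable_fun_ler.
by apply: measurable_fun_ltr.
Qed.

Section tonelli.
Variables f w : T -> R.
Hypotheses (mf : measurable_fun setT f) (mw : measurable_fun setT w).
Hypotheses (f0 : forall x, 0 <= f x) (w0 : forall x, 0 <= w x).

Let F (z : T * GR) : \bar R := (w z.1 * layer z.2 (f z.1))%:E.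

Let mF : measurable_fun setT F.
Proof.
apply/measurable_EFinP; apply: measurable_funM.
  by apply: measurableT_comp => //.
apply: measurable_layer => //.
exact: measurableT_comp.
Qed.

Let F0 z : (0 <= F z)%E.
Proof. by rewrite lee_fin mulr_ge0// layer_ge0. Qed.

(** Tonelli, with [f x] written as the integral of its layers. The weight [w] makes the formula
    applicable to a product one factor at a time. *)
Lemma layer_cake : (\int[m]_x (w x * f x)%:E =
  \int[leb]_t \int[m]_x (w x * layer t (f x))%:E)%E.
Proof.
rewrite -(fubini_tonelli F mF F0); apply: eq_integral => x _.
rewrite /F /=; under eq_integral do rewrite EFinM.
rewrite ge0_integralZl_EFin//.
- by rewrite integral_layer// EFinM.
- by move=> t _; rewrite lee_fin layer_ge0.
- by apply/measurable_EFinP; apply: measurable_layer => //; exact: measurable_id.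
Qed.

Lemma measurable_layer_integral :
  measurable_fun setT (fun t : GR => \int[m]_x (w x * layer t (f x))%:E)%E.
Proof. exact: (@measurable_fun_fubini_tonelli_G _ _ _ _ _ m F mF F0). Qed.

Lemma layer_integral_ge0 t : (0 <= \int[m]_x (w x * layer t (f x))%:E)%E.
Proof. by apply: integral_ge0 => x _; rewrite lee_fin mulr_ge0// layer_ge0. Qed.

End tonelli.
End layer_cake.

(** Two layer-cake decompositions express the integral of f g as the double integral over (s, t) of
    the joint tails, which are compared pointwise. *)
Lemma ge0_joint_tail_le {R : realType} d1 (T1 : measurableType d1)
    (m1 : probability T1 R) d2 (T2 : measurableType d2) (m2 : probability T2 R)
    (f1 g1 : T1 -> R) (f2 g2 : T2 -> R) :
  measurable_fun setT f1 -> measurable_fun setT g1 ->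
  measurable_fun setT f2 -> measurable_fun setT g2 ->
  (forall x, 0 <= f1 x) -> (forall x, 0 <= g1 x) ->
  (forall x, 0 <= f2 x) -> (forall x, 0 <= g2 x) ->
  (forall s t : R, 0 <= s -> 0 <= t ->
    (m1 [set x | (s < f1 x)%R /\ (t < g1 x)%R] <=
     m2 [set x | (s < f2 x)%R /\ (t < g2 x)%R])%E) ->
  (\int[m1]_x (f1 x * g1 x)%:E <= \int[m2]_x (f2 x * g2 x)%:E)%E.
Proof.
move=> mf1 mg1 mf2 mg2 f10 g10 f20 g20 tails.
rewrite !layer_cake//; apply: ge0_le_integral => //.
- by move=> t _; exact: layer_integral_ge0.
- exact: measurable_layer_integral.
- exact: measurable_layer_integral.
move=> t _.
have ml d (T : measurableType d) (g : T -> R) : measurable_fun setT g ->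
    measurable_fun setT (fun x => layer t (g x)).
  by move=> mg; apply: measurable_layer => //; exact: measurable_cst.
(* The layer of g, moved to the front, becomes the weight while f is decomposed in turn. *)
under eq_integral do rewrite mulrC.
under [leRHS]eq_integral do rewrite mulrC.
rewrite !layer_cake//; [|exact: ml|exact: ml].
apply: ge0_le_integral => //.
- by move=> s _; exact: layer_integral_ge0.
- by apply: measurable_layer_integral => //; exact: ml.
- by apply: measurable_layer_integral => //; exact: ml.
move=> s _.
have E d (T : measurableType d) (m : probability T R) (f g : T -> R) :
    measurable_fun setT f -> measurable_fun setT g ->
    (\int[m]_x (layer t (g x) * layer s (f x))%:E =
     if (0 <= s)%R && (0 <= t)%R then m [set x | (s < f x)%R /\ (t < g x)%R] else 0)%E.
  move=> mf mg; case: ifPn => [/andP[s0 t0]|st].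
    rewrite -[X in m X]setIT -integral_indic//; last first.
      have -> : [set x | s < f x /\ t < g x] =
          (setT `&` (fun x => s < f x) @^-1` [set true]) `&`
          (setT `&` (fun x => t < g x) @^-1` [set true]).
        by rewrite !setTI.
      by apply: measurableI; [apply: (measurable_fun_ltr _ _ measurableT)|
        apply: (measurable_fun_ltr _ _ measurableT)].
    apply: eq_integral => x _; congr EFin; rewrite /layer !indicE -natrM mulnb.
    congr (_%:R); apply: congr1.
    apply/idP/idP => [/andP[/set_mem /= h1 /set_mem /= h2]|/set_mem /= [h1 h2]].
      by apply/mem_set; move: h1 h2; rewrite /= !in_itv /= => /andP[_ h1] /andP[_ h2].
    by apply/andP; split; apply/mem_set; rewrite /= in_itv /= ?s0 ?t0.
  apply: integral0_eq => x _; rewrite /layer !indicE -natrM mulnb.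
  rewrite (_ : _ && _ = false)//; apply/negbTE.
  apply: contra st => /andP[/set_mem + /set_mem].
  by rewrite /= !in_itv/= => /andP[-> _] /andP[-> _].
rewrite !E//; case: ifP => // /andP[s0 t0]; exact: tails.
Qed.

(** * Comonotone pairs have the largest correlation *)

Section comonotone.
Context {R : realType}.

(** Both kinds of half-line occur: open ones are the tails of positive parts, closed ones the
    complements of the tails of negative parts. *)
Definition upper (A : set R) := forall x y, A x -> x <= y -> A y.

Lemma upper_measurable A : upper A -> measurable (A : set (measurableTypeR R)).
Proof.
move=> uA; apply: is_interval_measurable => x y Ax _ z /andP[xz _].
exact: uA xz.
Qed.

Lemma upper_gt s : upper [set x | s < x].
Proof. by move=> x y /= sx xy; exact: lt_le_trans xy. Qed.

Lemma upper_ge s : upper [set x | s <= x].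
Proof. by move=> x y /= sx xy; exact: le_trans xy. Qed.

Lemma measurable_preim_upper d (T : measurableType d) (X : T -> R) A :
  measurable_fun setT X -> upper A -> measurable (X @^-1` A).
Proof.
by move=> mX /upper_measurable mA; rewrite -[X in measurable X]setTI; exact: mX.
Qed.

Section compare.
Context d1 (T1 : measurableType d1) (m1 : probability T1 R).
Context d2 (T2 : measurableType d2) (m2 : probability T2 R).
Variables (X1 Y1 : T1 -> R) (X2 Y2 : T2 -> R).
Hypotheses (X1i : sqintegrable m1 X1) (Y1i : sqintegrable m1 Y1).
Hypotheses (X2i : sqintegrable m2 X2) (Y2i : sqintegrable m2 Y2).
Hypothesis eqX : forall A, upper A -> m1 (X1 @^-1` A) = m2 (X2 @^-1` A).
Hypothesis eqY : forall A, upper A -> m1 (Y1 @^-1` A) = m2 (Y2 @^-1` A).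
Hypothesis nested : forall A B, upper A -> upper B ->
  m2 (X2 @^-1` A `&` Y2 @^-1` B) = m2 (X2 @^-1` A) \/
  m2 (X2 @^-1` A `&` Y2 @^-1` B) = m2 (Y2 @^-1` B).

Let mX1 : measurable_fun setT X1. Proof. by case: X1i. Qed.
Let mY1 : measurable_fun setT Y1. Proof. by case: Y1i. Qed.
Let mX2 : measurable_fun setT X2. Proof. by case: X2i. Qed.
Let mY2 : measurable_fun setT Y2. Proof. by case: Y2i. Qed.

(** Fréchet's bound: a joint probability is at most either marginal, and by [nested] the second pair
    attains one of the two. *)
Let pp A B : upper A -> upper B ->
  (m1 (X1 @^-1` A `&` Y1 @^-1` B) <= m2 (X2 @^-1` A `&` Y2 @^-1` B))%E.
Proof.
move=> uA uB; have m1A := measurable_preim_upper mX1 uA.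
have m1B := measurable_preim_upper mY1 uB.
have [->|->] := nested uA uB; first by rewrite -eqX//; exact: measureIl.
by rewrite -eqY//; exact: measureIr.
Qed.

Let fin d (T : measurableType d) (m : probability T R) A :
  measurable A -> (m A < +oo)%E.
Proof. by move=> mA; rewrite (le_lt_trans (probability_le1 m mA))// ltry. Qed.

(** Complementing one event subtracts the joint probability from a common marginal and so reverses
    [pp]; complementing both, in [nn], restores its direction. *)
Let pn A B : upper A -> upper B ->
  (m2 (X2 @^-1` A `&` ~` (Y2 @^-1` B)) <= m1 (X1 @^-1` A `&` ~` (Y1 @^-1` B)))%E.
Proof.
move=> uA uB; have m1A := measurable_preim_upper mX1 uA.
have m1B := measurable_preim_upper mY1 uB.
have m2A := measurable_preim_upper mX2 uA.
have m2B := measurable_preim_upper mY2 uB.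
rewrite -!setDE !measureD//; [|exact: fin..].
have le21 : (m2 (X2 @^-1` A) <= m1 (X1 @^-1` A))%E by rewrite eqX.
exact: leeB le21 (pp uA uB).
Qed.

Let np A B : upper A -> upper B ->
  (m2 (~` (X2 @^-1` A) `&` Y2 @^-1` B) <= m1 (~` (X1 @^-1` A) `&` Y1 @^-1` B))%E.
Proof.
move=> uA uB; have m1A := measurable_preim_upper mX1 uA.
have m1B := measurable_preim_upper mY1 uB.
have m2A := measurable_preim_upper mX2 uA.
have m2B := measurable_preim_upper mY2 uB.
rewrite ![~` _ `&` _]setIC -!setDE !measureD//; [|exact: fin..].
have le21 : (m2 (Y2 @^-1` B) <= m1 (Y1 @^-1` B))%E by rewrite eqY.
by rewrite ![_ @^-1` B `&` _]setIC; exact: leeB le21 (pp uA uB).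
Qed.

Let nn A B : upper A -> upper B ->
  (m1 (~` (X1 @^-1` A) `&` ~` (Y1 @^-1` B)) <=
   m2 (~` (X2 @^-1` A) `&` ~` (Y2 @^-1` B)))%E.
Proof.
move=> uA uB; have m1A := measurable_preim_upper mX1 uA.
have m1B := measurable_preim_upper mY1 uB.
have m2A := measurable_preim_upper mX2 uA.
have m2B := measurable_preim_upper mY2 uB.
rewrite -!setDE !measureD//; do ?[exact: measurableC]; do ?[by apply: fin; exact: measurableC].
have le12 : (m1 (~` (X1 @^-1` A)) <= m2 (~` (X2 @^-1` A)))%E.
  by rewrite !probability_setC// eqX.
exact: leeB le12 (np uA uB).
Qed.

Let pos (x : R) := Num.max x 0.
Let neg (x : R) := Num.max (- x) 0.

Let pos_ge0 x : 0 <= pos x. Proof. by rewrite le_max lexx orbT. Qed.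
Let neg_ge0 x : 0 <= neg x. Proof. by rewrite le_max lexx orbT. Qed.

Let posneg x : x = pos x - neg x.
Proof. by rewrite /pos /neg; case: leP => ?; case: leP => ?; lra. Qed.

Let pos_gt s x : 0 <= s -> (s < pos x) = (s < x).
Proof. by move=> s0; rewrite lt_max [X in _ || X]ltNge s0 orbF. Qed.

Let neg_gt s x : 0 <= s -> (s < neg x) = ~~ (- s <= x).
Proof. by move=> s0; rewrite lt_max [X in _ || X]ltNge s0 orbF -ltNge ltrNr. Qed.

Let mpos d (T : measurableType d) (f : T -> R) : measurable_fun setT f ->
  measurable_fun setT (fun x => pos (f x)).
Proof. by move=> mf; exact: measurable_maxr. Qed.

Let mneg d (T : measurableType d) (f : T -> R) : measurable_fun setT f ->
  measurable_fun setT (fun x => neg (f x)).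
Proof.
by move=> mf; apply: measurable_maxr => //; exact: measurableT_comp.
Qed.

Let posi d (T : measurableType d) (m : probability T R) f :
  sqintegrable m f -> sqintegrable m (fun x => pos (f x)).
Proof.
move=> [mf f2]; apply: (@le_sqintegrable _ _ _ _ _ f) => //; first exact: mpos.
by move=> x; rewrite ger0_norm// /pos ge_max ler_norm normr_ge0.
Qed.

Let negi d (T : measurableType d) (m : probability T R) f :
  sqintegrable m f -> sqintegrable m (fun x => neg (f x)).
Proof.
move=> [mf f2]; apply: (@le_sqintegrable _ _ _ _ _ f) => //; first exact: mneg.
by move=> x; rewrite ger0_norm// /neg ge_max -normrN ler_norm normr_ge0.
Qed.

Let toR d (T : measurableType d) (m : probability T R)
    d' (T' : measurableType d') (m' : probability T' R) f g f' g' :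
  sqintegrable m f -> sqintegrable m g -> sqintegrable m' f' -> sqintegrable m' g' ->
  (\int[m]_x (f x * g x)%:E <= \int[m']_x (f' x * g' x)%:E)%E ->
  \int[m]_x (f x * g x) <= \int[m']_x (f' x * g' x).
Proof.
by move=> *; rewrite -lee_fin -!EFin_Rintegral//; exact: sqintegrable_mul.
Qed.

Let expand d (T : measurableType d) (m : probability T R) f g :
  sqintegrable m f -> sqintegrable m g ->
  \int[m]_x (f x * g x) =
   \int[m]_x (pos (f x) * pos (g x)) - \int[m]_x (pos (f x) * neg (g x)) -
   \int[m]_x (neg (f x) * pos (g x)) + \int[m]_x (neg (f x) * neg (g x)).
Proof.
move=> fi gi.
have i1 := sqintegrable_mul (posi fi) (posi gi).
have i2 := sqintegrable_mul (posi fi) (negi gi).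
have i3 := sqintegrable_mul (negi fi) (posi gi).
have i4 := sqintegrable_mul (negi fi) (negi gi).
have i5 := rintegrableB i1 i2.
have i6 := rintegrableB i5 i3.
rewrite -Rintegral_sub// -Rintegral_sub// -Rintegral_add//.
by apply: eq_Rintegral => x _; rewrite {1}(posneg (f x)) {1}(posneg (g x)); ring.
Qed.

(** Tails can be compared for nonnegative functions only, hence the split into four products of
    positive and negative parts. The mixed products carry a minus sign, which matches the reversed
    inequalities [pn] and [np]. *)
Lemma comonotone_le : \int[m1]_x (X1 x * Y1 x) <= \int[m2]_x (X2 x * Y2 x).
Proof.
rewrite (expand X1i Y1i) (expand X2i Y2i).
suff: [/\ \int[m1]_x (pos (X1 x) * pos (Y1 x)) <= \int[m2]_x (pos (X2 x) * pos (Y2 x)),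
  \int[m2]_x (pos (X2 x) * neg (Y2 x)) <= \int[m1]_x (pos (X1 x) * neg (Y1 x)),
  \int[m2]_x (neg (X2 x) * pos (Y2 x)) <= \int[m1]_x (neg (X1 x) * pos (Y1 x)) &
  \int[m1]_x (neg (X1 x) * neg (Y1 x)) <= \int[m2]_x (neg (X2 x) * neg (Y2 x))].
  by case; lra.
have P d (T : measurableType d) (X : T -> R) s : 0 <= s ->
    [set x | s < pos (X x)] = X @^-1` [set x | s < x].
  by move=> s0; apply/seteqP; split => x /=; rewrite pos_gt.
have N d (T : measurableType d) (X : T -> R) s : 0 <= s ->
    [set x | s < neg (X x)] = ~` (X @^-1` [set x | - s <= x]).
  by move=> s0; apply/seteqP; split => x /=; rewrite neg_gt// => /negP.
have I T (f g : T -> R) s t : [set x | s < f x /\ t < g x] =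
  [set x | s < f x] `&` [set x | t < g x] by [].
split; apply: toR; (try by [exact: posi|exact: negi]);
  (apply: ge0_joint_tail_le => //; [(try exact: mpos); exact: mneg..|]);
  move=> s t s0 t0; rewrite !I ?N ?P//.
- by apply: pp; exact: upper_gt.
- by apply: pn; [exact: upper_gt|exact: upper_ge].
- by apply: np; [exact: upper_ge|exact: upper_gt].
- by apply: nn; exact: upper_ge.
Qed.

End compare.
End comonotone.

(** * Quantile maps *)

Section quantiles.
Context d (T : measurableType d) {R : realType} (P : probability T R).
Variable X : {RV P >-> R}.
Local Open Scope ereal_scope.

(* The infimum defining the quantile is attained, by right-continuity. *)
Lemma quantile_le (t : \bar R) y : 0 < t -> t < 1 ->
  (quantile (distribution P X) t <= y)%R = (t <= cdf X y).
Proof.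
move=> t0 t1; rewrite /quantile; set S := [set x | _].
have SE x : S x = (t <= cdf X x) by [].
(* The limits of the cdf at +oo and -oo turn t < 1 into nonemptiness and 0 < t into a lower bound,
   without which [inf] would be a default value. *)
have S0 : S !=set0.
  apply: contrapT => nS; have : 1 <= t.
    apply: (cvge_to_le (cvg_cdfy1 X)); near=> x.
    by rewrite leNgt; apply/negP => tx; apply: nS; exists x; rewrite SE ltW.
  by rewrite leNgt t1.
have lbS : has_lbound S.
  apply: contrapT => nS; have : t <= 0.
    apply: (cvge_to_ge (cvg_cdfNy0 X)); near=> x.
    rewrite leNgt; apply/negP => xt; apply: nS; exists x => z; rewrite SE => tz.
    rewrite leNgt; apply/negP => zx; move: xt; rewrite ltNge (le_trans tz)//.
    by rewrite cdf_nondecreasing// ltW.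
  by rewrite leNgt t0.
apply/idP/idP => [Sy|ty]; last exact: ge_inf.
apply: (cvge_to_ge (@cdf_right_continuous _ _ _ P X y)); near=> z.
have yz : (y < z)%R by near: z; exact: nbhs_right_gt.
have [w Sw wz] := inf_lt S0 (le_lt_trans Sy yz).
by rewrite (le_trans Sw)// cdf_nondecreasing// ltW.
Unshelve. all: by end_near. Qed.

Hypothesis atomless : forall r, P (X @^-1` [set r]) = 0.

(** One inequality is the attainment of the infimum. For the other, the absence of an atom at r
    makes F(r) the limit of F(r - 1/(k+1)), and these stay below t because r is the least point
    where F reaches t. *)
Lemma cdf_quantile (t : \bar R) : 0 < t -> t < 1 ->
  cdf X (quantile (distribution P X) t) = t.
Proof.
move=> t0 t1; set r := quantile _ t; apply/eqP; rewrite eq_le.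
rewrite -quantile_le// lexx andbT.
pose F k := X @^-1` `]-oo, (r - k.+1%:R^-1)%R].
have itvE : \bigcup_k `]-oo, (r - k.+1%:R^-1)%R]%classic = `]-oo, r[%classic.
  apply/seteqP; split => [x [k _] /=|x /=]; rewrite !in_itv/=.
    by move=> /le_lt_trans -> //; rewrite ltrBlDr ltrDl invr_gt0 ltr0n.
  move=> xr; have : `[x, r[%classic x by rewrite /= in_itv/= lexx.
  rewrite itv_bnd_open_bigcup => -[k _] /=; rewrite in_itv/= => /andP[_ xk].
  by exists k.
have -> : cdf X r = P (\bigcup_k F k).
  rewrite /F -preimage_bigcup itvE /cdf /distribution /pushforward.
  rewrite -(@setUitv1 _ _ _ _ true)//= preimage_setU.
  rewrite measureU; [|exact: measurable_funPTI|exact: measurable_funPTI|].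
  - by rewrite -[RHS]adde0; congr (_ + _); exact: atomless.
  - by apply/seteqP; split => // x /= []; rewrite in_itv/= => /[swap] ->; rewrite ltxx.
have FE k : P (F k) = cdf X (r - k.+1%:R^-1)%R by [].
have cF : P \o F @ \oo --> P (\bigcup_n F n).
  apply: nondecreasing_cvg_mu.
  - by move=> i; exact: measurable_funPTI.
  - by apply: bigcup_measurable => i _; exact: measurable_funPTI.
  - move=> i j ij; apply/subsetPset; apply: preimage_subset; apply: subset_itvl.
    by rewrite bnd_simp lerD2l lerN2 lef_pV2 ?posrE// ler_nat.
apply: (cvge_to_le cF); near=> k; rewrite /= FE.
rewrite leNgt; apply/negP => /ltW; rewrite -quantile_le// -/r.
by rewrite leNgt ltrBlDr ltrDl invr_gt0 ltr0n.
Unshelve. all: by end_near. Qed.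

Let mcdfX : measurable_fun setT (fun x => cdf X (X x)).
Proof. by apply: measurableT_comp => //; exact: cdf_measurable. Qed.

Let mle t : measurable [set x | cdf X (X x) <= t].
Proof. by rewrite -[X in measurable X]setTI; exact: emeasurable_fun_infty_c. Qed.

Let mI r : measurable (X @^-1` `]-oo, r]).
Proof. exact: measurable_funPTI. Qed.

Let cdfle_ge t : 0 <= t -> t < 1 -> t <= P [set x | cdf X (X x) <= t].
Proof.
rewrite le_eqVlt => /predU1P[<- _|t0 t1]; first by [].
rewrite -{1}(cdf_quantile t0 t1) /cdf /distribution /pushforward.
apply: le_measure; rewrite ?inE; [exact: mI || exact: mle..|].
move=> x /=; rewrite in_itv/= => xr.
by rewrite -[leRHS](cdf_quantile t0 t1); exact: cdf_nondecreasing.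
Qed.

(** A level s > t is taken because the cdf may be flat at height t: then F(X) <= t does not give X
    <= q(t), but it does give X <= q(s). *)
Let cdfle_le t s : 0 <= t -> t < s -> s < 1 -> P [set x | cdf X (X x) <= t] <= s.
Proof.
move=> t0 ts s1; have s0 := le_lt_trans t0 ts.
rewrite -[leRHS](cdf_quantile s0 s1) /cdf /distribution /pushforward.
apply: le_measure; rewrite ?inE; [exact: mI || exact: mle..|].
move=> x /= xt; rewrite in_itv/= leNgt; apply/negP => /ltW xr.
move: ts; rewrite ltNge => /negP; apply; apply: le_trans xt.
by rewrite -[leLHS](cdf_quantile s0 s1); exact: cdf_nondecreasing.
Qed.

(** The probability integral transform. The upper bound [cdfle_le] holds at levels strictly above t,
    hence the epsilon. *)
Lemma cdf_uniform t : 0 <= t -> t <= 1 -> P [set x | cdf X (X x) <= t] = t.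
Proof.
move=> t0; rewrite le_eqVlt => /predU1P[->|t1].
  rewrite (_ : [set x | _] = setT) ?probability_setT//.
  by apply/seteqP; split => // x _ /=; exact: cdf_le1.
apply/eqP; rewrite eq_le cdfle_ge// andbT.
case: t t0 t1 => // t; rewrite lee_fin lte_fin => t0 t1.
apply/lee_addgt0Pr => e e0.
(* The midpoint of t and 1 keeps s below 1, while t < s <= t + e. *)
pose s := Num.min (t + e)%R ((t + 1) / 2)%R.
apply: (@le_trans _ _ s%:E).
  apply: cdfle_le; rewrite ?lee_fin ?lte_fin//.
  - by rewrite lt_min; apply/andP; split; lra.
  - by rewrite gt_min; apply/orP; right; lra.
by rewrite -EFinD lee_fin ge_min lexx.
Qed.

(** Where F(X) is 0 or 1, so that [quantile] may return a conventional value. *)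
Definition cdf_extreme := [set x | ~~ (0 < cdf X (X x) < 1)].

Lemma measurable_cdf_extreme : measurable cdf_extreme.
Proof.
have -> : cdf_extreme = [set x | cdf X (X x) <= 0] `|` ~` [set x | cdf X (X x) < 1].
  apply/seteqP; split => x; rewrite /cdf_extreme /= negb_and -leNgt.
    by move=> /orP[->|/negP]; [left|right].
  by move=> [->//|/negP->]; rewrite orbT.
apply: measurableU => //; apply: measurableC.
by rewrite -[X in measurable X]setTI; exact: emeasurable_fun_infty_o.
Qed.

(** By [cdf_uniform], F(X) <= 0 has probability 0 and F(X) > t has probability 1 - t, which is small
    for t near 1. *)
Lemma cdf_extreme0 : P cdf_extreme = 0.
Proof.
apply/eqP; rewrite -measure_le0; apply/lee_addgt0Pr => e e0; rewrite add0e.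
(* The bound 1/2 keeps t positive when e is large. *)
pose t := Num.max (1 - e)%R (1 / 2)%R.
have t0 : (0 < t)%R by rewrite lt_max; apply/orP; right; lra.
have t1 : (t < 1)%R by rewrite gt_max; apply/andP; split; lra.
have et : (1 - e <= t)%R by rewrite le_max lexx.
have te : (1 - t <= e)%R by lra.
apply: (@le_trans _ _ (P ([set x | cdf X (X x) <= 0] `|`
    ~` [set x | cdf X (X x) <= t%:E]))).
  apply: le_measure; rewrite ?inE.
  - exact: measurable_cdf_extreme.
  - by apply: measurableU => //; exact: measurableC.
  - move=> x; rewrite /cdf_extreme /= negb_and -!leNgt => /orP[|h]; first by left.
    by right => /= /(le_trans h); rewrite lee_fin leNgt t1.
have tail : P [set x | cdf X (X x) <= 0] +
    P (~` [set x | cdf X (X x) <= t%:E]) <= e%:E.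
  rewrite probability_setC// !cdf_uniform ?lee_fin ?(ltW t0) ?(ltW t1)//.
  by rewrite add0r.
exact: le_trans (measureU2 _ (mle 0) (measurableC (mle t%:E))) tail.
Qed.

End quantiles.

(** The open right rays are stable under intersection, generate the Borel sets, and those starting
    at the integers -k cover the line. *)
Lemma eq_law_le {R : realType} (P Q : probability R R) :
  (forall r, P `]-oo, r]%classic = Q `]-oo, r]%classic) ->
  forall A, measurable A -> P A = Q A.
Proof.
move=> PQ A mA.
apply: (@measure_unique _ R R (@RGenOInfty.G R)
  (fun k => `]- k%:R, +oo[%classic) _ _ _ _ P Q _ _ A mA) => //.
- exact: RGenOInfty.measurableE.
- move=> _ _ [x ->] [y ->]; exists (Num.max x y).
  by apply/seteqP; split => z /=; rewrite !in_itv/= !andbT gt_max => /andP.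
- by move=> k; exists (- k%:R).
- rewrite -subTset => x _; exists (Num.bound `|x|) => //=.
  rewrite in_itv/= andbT ltrNl (le_lt_trans _ (archi_boundP (normr_ge0 x)))//.
  by rewrite -normrN ler_norm.
- by move=> _ [x ->]; rewrite -setCitvl [LHS]probability_setC// [RHS]probability_setC// PQ.
- by move=> k; rewrite (le_lt_trans (probability_le1 P _))// ltry.
Qed.

(** * Monotone rearrangement of one random variable along another *)

Section rearrangement.
Context {R : realType} d (T : measurableType d) (P : probability T R).
Context d' (T' : measurableType d') (Q : probability T' R).
Variables (X : {RV P >-> R}) (Y : {RV Q >-> R}).
Hypothesis atomless : forall r, P (X @^-1` [set r]) = 0%E.

(** Defined on the space of [X] rather than on the line, in the form to which [ot_map_1d] at the
    projected point is convertible. *)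
Definition rearrangement x := quantile (distribution Q Y) (cdf X (X x)).

(* [quantile] is junk outside (0, 1), where it need not depend measurably on
   the parameters of [X] and [Y]. *)
Definition rearrangement0 x :=
  if (0 < cdf X (X x) < 1)%E then rearrangement x else 0.

Lemma rearrangement0E x : ~ cdf_extreme X x -> rearrangement0 x = rearrangement x.
Proof. by rewrite /cdf_extreme/= /rearrangement0; case: ifP. Qed.

Lemma rearrangement_le x y : ~ cdf_extreme X x ->
  (rearrangement x <= y) = (cdf X (X x) <= cdf Y y)%E.
Proof. by move=> /negP; rewrite negbK => /andP[h0 h1]; rewrite quantile_le. Qed.

Let mcdfX : measurable_fun setT (fun x => cdf X (X x)).
Proof. by apply: measurableT_comp => //; exact: cdf_measurable. Qed.

Lemma measurable_rearrangement0 : measurable_fun setT rearrangement0.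
Proof.
move=> mT; apply: (measurability _ (RGenOInfty.measurableE R)) => // _ [_ [y ->] <-].
have mE := measurable_cdf_extreme X.
have -> : setT `&` rearrangement0 @^-1` `]y, +oo[ =
    (~` cdf_extreme X `&` [set x | (cdf Y y < cdf X (X x))%E]) `|`
    (cdf_extreme X `&` [set x | y < 0]).
  rewrite setTI; apply/seteqP; split => x /=; rewrite in_itv/= andbT.
    have [Ex|nEx] := pselect (cdf_extreme X x); [right|left].
      by split => //; move: H; rewrite /rearrangement0 (negPf Ex).
    split=> //; move: H; rewrite rearrangement0E// !ltNge.
    by rewrite rearrangement_le// => /negP.
  move=> [[nEx]|[Ex]].
    by rewrite rearrangement0E// !ltNge rearrangement_le.
  by rewrite /rearrangement0 (negPf Ex).
apply: measurableU; apply: measurableI => //; first exact: measurableC.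
  by rewrite -[X in measurable X]setTI; exact: emeasurable_fun_o_infty.
by case: (ltP y 0) => _; [rewrite (_ : [set _ | _] = setT)//|
  rewrite (_ : [set _ | _] = set0)//]; apply/seteqP; split.
Qed.

(** It differs from [rearrangement0] only where F(X) is exactly 0 or 1, and it is constant on each
    of these two measurable sets. *)
Lemma measurable_rearrangement : measurable_fun setT rearrangement.
Proof.
pose I0 := [set x | (cdf X (X x) <= 0)%E].
pose I1 := [set x | (1 <= cdf X (X x))%E].
have mI0 : measurable I0.
  by rewrite -[X in measurable X]setTI; exact: emeasurable_fun_infty_c.
have mI1 : measurable I1.
  by rewrite -[X in measurable X]setTI; exact: emeasurable_fun_c_infty.
pose c t := quantile (distribution Q Y) t.
have -> : rearrangement =
    (fun x => rearrangement0 x + (c 0%E * \1_I0 x + c 1%E * \1_I1 x)).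
  apply/funext => x; rewrite !indicE.
  have [Ex|nEx] := pselect (cdf_extreme X x).
    rewrite /rearrangement0 (negPf Ex) add0r /rearrangement.
    move: Ex; rewrite /cdf_extreme /= negb_and -!leNgt => /orP[h|h].
      have e : cdf X (X x) = 0%E by apply/eqP; rewrite eq_le h cdf_ge0.
      rewrite mem_set// memNset; last by rewrite /I1/= e leNgt lte01.
      by rewrite e mulr1 mulr0 addr0.
    have e : cdf X (X x) = 1%E by apply/eqP; rewrite eq_le h cdf_le1.
    rewrite memNset ?mem_set//; last by rewrite /I0/= e leNgt lte01.
    by rewrite e mulr1 mulr0 add0r.
  rewrite rearrangement0E//; move/negP: nEx; rewrite negbK => /andP[h0 h1].
  rewrite memNset ?memNset ?mulr0 ?addr0//.
    by rewrite /I1/= leNgt h1.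
  by rewrite /I0/= leNgt h0.
apply: measurable_funD; first exact: measurable_rearrangement0.
by apply: measurable_funD; apply: measurable_funM => //; exact: measurable_indic.
Qed.

Let eq_off (A B : set T) : measurable A -> measurable B ->
  (forall x, ~ cdf_extreme X x -> A x -> B x) -> (P A <= P B)%E.
Proof.
move=> mA mB AB; have mE := measurable_cdf_extreme X.
apply: (@le_trans _ _ (P (B `|` cdf_extreme X))).
  apply: le_measure; rewrite ?inE//; first exact: measurableU.
  move=> x Ax; have [Ex|nEx] := pselect (cdf_extreme X x); first by right.
  by left; exact: AB.
have E0 : (P B + P (cdf_extreme X) <= P B)%E by rewrite cdf_extreme0// adde0.
exact: le_trans (measureU2 _ mB mE) E0.
Qed.

Let mrearrangement_le y : measurable (rearrangement @^-1` `]-oo, y]%classic).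
Proof. by rewrite -[X in measurable X]setTI; exact: measurable_rearrangement. Qed.

(** Off a null set the rearrangement is at most y exactly when F(X) <= G(y), G being the cdf of [Y],
    and F(X) is uniform. *)
Lemma cdf_rearrangement y : P (rearrangement @^-1` `]-oo, y]%classic) = cdf Y y.
Proof.
rewrite -[RHS](cdf_uniform atomless)//; last exact: cdf_le1.
have m2 : measurable [set x | (cdf X (X x) <= cdf Y y)%E].
  by rewrite -[X in measurable X]setTI; exact: emeasurable_fun_infty_c.
apply/eqP; rewrite eq_le; apply/andP; split; apply: eq_off => // x nEx /=;
  by rewrite in_itv/= rearrangement_le.
Qed.

Lemma rearrangement_law (A : set (measurableTypeR R)) : measurable A ->
  P (rearrangement @^-1` A) = distribution Q Y A.
Proof.
pose f : {RV P >-> R} := mfun_Sub (mem_set measurable_rearrangement).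
move=> mA.
apply: (@eq_law_le _ (distribution P f) (distribution Q Y)) => // r.
exact: cdf_rearrangement.
Qed.

(** Off a null set, either the first event implies the second, or some x has X(x) in A and its
    rearrangement outside B. In that case monotonicity puts X(z) above X(x), hence in A, for every z
    whose rearrangement lies in B. *)
Lemma rearrangement_nested A B : upper A -> upper B ->
  P (X @^-1` A `&` rearrangement @^-1` B) = P (X @^-1` A) \/
  P (X @^-1` A `&` rearrangement @^-1` B) = P (rearrangement @^-1` B).
Proof.
move=> uA uB.
have mA : measurable (X @^-1` A) by apply: measurable_preim_upper.
have mB : measurable (rearrangement @^-1` B).
  by apply: measurable_preim_upper => //; exact: measurable_rearrangement.
have mAB := measurableI _ _ mA mB.
have [AB|] := pselect (forall x, ~ cdf_extreme X x -> A (X x) -> B (rearrangement x)).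
  left; apply/eqP; rewrite eq_le measureIl//=.
  by apply: eq_off => // x nEx /= Ax; split => //; exact: AB.
move=> /existsNP[x /not_implyP[nEx /not_implyP[Ax nBx]]].
right; apply/eqP; rewrite eq_le measureIr//=.
apply: eq_off => // z nEz /= Bz; split => //.
have [xz|zx] := leP (X x) (X z); first exact: uA xz.
exfalso; apply: nBx; apply: uB Bz _; rewrite rearrangement_le//.
apply: (@le_trans _ _ (cdf X (X x))); first by apply: cdf_nondecreasing; exact: ltW.
by rewrite -rearrangement_le.
Qed.

End rearrangement.

(** * Hyperplanes and rotation-invariant measures *)

Section hyperplanes.
Context {R : realType}.

Lemma lebesgue_cV_set0 n : @lebesgue_cV R n set0 = 0%E.
Proof.
elim: n => [|n IH] /=; first by rewrite measure0.
by apply: integral0_eq => t _; exact: IH.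
Qed.

Lemma integral_singleton (f : R -> \bar R) t0 : (forall t, t != t0 -> f t = 0%E) ->
  (\int[lebesgue_measure]_t f t = 0)%E.
Proof.
move=> f0; have -> : f = f \_ [set t0].
  by apply/funext => t; rewrite patchE; case: ifPn => //; rewrite notin_setE => /eqP; exact: f0.
by rewrite -integral_mkcond integral_set1.
Qed.

(* No measurability is required of [A]: only the first coordinate is ever
   integrated, and the integrand vanishes off a single point. *)
Lemma lebesgue_cV_hyperplane n (theta : 'cV[R]_n) r (A : set 'cV[R]_n) :
  theta != 0 -> A `<=` [set x | dot x theta = r] -> lebesgue_cV A = 0%E.
Proof.
elim: n theta r A => [theta|n IH theta r A theta0 Ar] /=.
  by rewrite [theta]flatmx0 eqxx.
pose theta' : 'cV[R]_(1 + n) := theta.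
have dotE (t : R) y : dot (col_mx (t%:M : 'cV[R]_1) y : 'cV[R]_n.+1) theta =
    t * theta 0 0 + dot y (dsubmx theta').
  rewrite /dot big_ord_recl; congr (_ + _).
    congr (_ * _).
    transitivity (col_mx (t%:M : 'cV[R]_1) y (lshift n ord0) 0).
      by congr (fun_of_matrix _ _ _); exact: val_inj.
    by rewrite col_mxEu mxE mulr1n.
  apply: eq_bigr => i _; congr (_ * _).
    transitivity (col_mx (t%:M : 'cV[R]_1) y (rshift 1 i) 0).
      by congr (fun_of_matrix _ _ _); exact: val_inj.
    by rewrite col_mxEd.
  by rewrite mxE; congr (fun_of_matrix _ _ _); exact: val_inj.
(* If the trailing part of [theta] is nonzero, every section at fixed t lies in a hyperplane of R^n;
   otherwise only t = r / theta_0 has a nonempty section. *)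
have [d0|d0] := eqVneq (dsubmx theta') 0; last first.
  apply: integral0_eq => t _; apply: (IH (dsubmx theta') (r - t * theta 0 0)) => //.
  by move=> y /= /Ar /=; rewrite dotE => <-; rewrite addrC addKr.
have t00 : theta 0 0 != 0.
  apply: contra theta0 => /eqP t00; apply/eqP/colP => i; rewrite mxE.
  have [j ->|->] := unliftP ord0 i; last by rewrite -[RHS]t00.
  have /colP/(_ j) := d0; rewrite !mxE => <-.
  by congr (fun_of_matrix _ _ _); exact: val_inj.
apply: (@integral_singleton _ (r / theta 0 0)) => t tr.
have -> : [set y : 'cV[R]_n | A (col_mx (t%:M : 'cV[R]_1) y)] = set0; last exact: lebesgue_cV_set0.
rewrite -subset0 => y /= /Ar /=; rewrite dotE d0 /dot big1.
  by move=> h; case/eqP: tr; rewrite -h addr0 mulfK.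
by move=> i _; rewrite mxE mulr0.
Qed.

Lemma W2ac_hyperplane n (sigma : probability 'cV[R]_n R) (theta : 'cV[R]_n) r :
  W2ac_space sigma -> theta != 0 -> sigma [set x | dot x theta = r] = 0%E.
Proof.
(* Domination is tested on the subsets of the hyperplane, whence the form of
   [lebesgue_cV_hyperplane]. *)
move=> [_ ac] theta0; apply: (ac [set x | dot x theta = r]) => //.
  by move=> A _; exact: lebesgue_cV_hyperplane.
have -> : [set x | dot x theta = r] = (dot ^~ theta) @^-1` [set r] by [].
rewrite -[X in measurable X]setTI.
have m : measurable_fun setT (fun x : 'cV[R]_n => dot x theta).
  by apply: measurable_dot => //; exact: measurable_cst.
exact: m.
Qed.

End hyperplanes.

(** * Uniqueness of the rotation-invariant probability on the sphere *)

Section orthogonal_invariance.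
Context {R : realType} {n : nat}.

Lemma measurable_orthogonal_group : measurable (@orthogonal_group R n).
Proof.
pose f (Q : 'M[R]_n) := \sum_(i < n) \sum_(j < n) ((Q^T *m Q - 1%:M) i j) ^+ 2.
have -> : @orthogonal_group R n = setT `&` f @^-1` [set 0].
  rewrite setTI; apply/seteqP; split => Q; rewrite /orthogonal_group /f /=.
    move=> ->; rewrite subrr big1// => i _; rewrite big1// => j _.
    by rewrite mxE expr0n.
  move/eqP; rewrite psumr_eq0; last first.
    by move=> i _; apply: sumr_ge0 => j _; exact: sqr_ge0.
  move=> /allP h; apply/eqP; rewrite -subr_eq0; apply/eqP/matrixP => i j.
  have := h i (mem_index_enum i); rewrite /= psumr_eq0; last first.
    by move=> k _; exact: sqr_ge0.
  move=> /allP/(_ j (mem_index_enum j)) /=.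
  by rewrite sqrf_eq0 => /eqP ->; rewrite mxE.
have mf : measurable_fun setT f.
  apply: measurable_Rsum => i; apply: measurable_Rsum => j.
  apply: measurable_funX; apply: measurable_entry_comp.
  apply: measurable_add_mx; last exact: measurable_cst.
  by apply: measurable_mulmx => //; exact: measurable_trmx.
exact: mf.
Qed.

Lemma measurable_unit_sphere : measurable (@unit_sphere R n).
Proof.
have -> : @unit_sphere R n = setT `&` (fun x => dot x x) @^-1` [set 1].
  rewrite setTI; apply/seteqP; split => x; rewrite /unit_sphere/=.
    by move=> x1; rewrite -enorm_sqr x1 expr1n.
  by move=> x1; rewrite /enorm x1 sqrtr1.
have m : measurable_fun setT (fun x : 'cV[R]_n => dot x x) by exact: measurable_dot.
exact: m.
Qed.

Lemma sphere_dot (x : 'cV[R]_n) : unit_sphere n x -> dot x x = 1.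
Proof. by rewrite /unit_sphere /= => x1; rewrite -enorm_sqr x1 expr1n. Qed.

Lemma sphere_neq0 (x : 'cV[R]_n) : unit_sphere n x -> x != 0.
Proof. by move=> /sphere_dot x1; rewrite -dot_eq0 x1 oner_eq0. Qed.

Lemma orthogonal_group_tr (Q : 'M[R]_n) :
  orthogonal_group n Q -> orthogonal_group n Q^T.
Proof. by move=> oQ; rewrite /orthogonal_group /= trmxK; exact: orthogonal_tr. Qed.

Lemma orthogonal_transitive (x y : 'cV[R]_n) :
  unit_sphere n x -> unit_sphere n y ->
  exists2 Q, orthogonal_group n Q & Q *m x = y.
Proof.
move=> /sphere_dot x1 /sphere_dot y1.
have [->|xy] := eqVneq x y.
  by exists 1%:M; rewrite ?mul1mx// /orthogonal_group/= trmx1 mul1mx.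
have [v vE] : exists v, v = x - y by exists (x - y).
have v0 : dot v v != 0 by rewrite dot_eq0 vE subr_eq0.
(* Since |x| = |y|, one has v.v = 2 v.x, so the reflection along v subtracts exactly v from x. *)
have vx : dot v v = 2 * dot v x.
  by rewrite vE !dotBl !dotBr x1 y1 (dotC y x); ring.
(* the reflection in the hyperplane bisecting [x] and [y] *)
pose Q : 'M[R]_n := 1%:M - (2 / dot v v) *: (v *m v^T).
have Qt : Q^T = Q.
  by rewrite /Q linearB /= linearZ /= trmx_mul trmxK trmx1.
have Qm (z : 'cV[R]_n) : Q *m z = z - (2 / dot v v * dot v z) *: v.
  rewrite /Q mulmxBl mul1mx -scalemxAl -mulmxA.
  by rewrite [v^T *m z]mx11_scalar -dot_mx mul_mx_scalar scalerA.
have QQ (z : 'cV[R]_n) : Q *m (Q *m z) = z.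
  rewrite [Q *m z]Qm Qm dotBr dotZr.
  rewrite -addrA -opprD -scalerDl [X in X *: v](_ : _ = 0) ?scale0r ?subr0//.
  by field.
exists Q; last first.
  rewrite Qm [X in X *: v](_ : _ = 1) ?scale1r ?vE ?subKr// -vE.
  by apply: (mulIf v0); rewrite mul1r [RHS]vx; field.
rewrite /orthogonal_group/= Qt; apply/matrixP => i j.
by have := QQ (delta_mx j 0); rewrite mulmxA -colE => /colP/(_ i); rewrite !mxE eqxx andbT.
Qed.

Section uniform_sphere_law.
Variables (m : probability 'M[R]_n R) (haar : haar_orthogonal m).

Let delta_sphere i : unit_sphere n (delta_mx i 0 : 'cV[R]_n).
Proof. by rewrite /unit_sphere /= /enorm dot_delta mxE !eqxx sqrtr1. Qed.

(** The transpose suits left invariance: replacing S by Q^T S turns S^T x into S^T (Q x), so [rot A]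
    is constant on the sphere. *)
Let rot (A : set 'cV[R]_n) x := m [set Q | A (Q^T *m x)].

Let mrot : measurable_fun setT (fun z : 'cV[R]_n * 'M[R]_n => z.2^T *m z.1).
Proof. by apply: measurable_mulmx => //; exact: measurable_trmx. Qed.

Let rotE (A : set 'cV[R]_n) x i : measurable A -> unit_sphere n x ->
  rot A x = rot A (delta_mx i 0).
Proof.
move=> mA x1; have [Q oQ Qi] := orthogonal_transitive (delta_sphere i) x1.
have [_ inv] := haar; rewrite /rot -Qi.
rewrite -[RHS](inv Q^T _ (orthogonal_group_tr oQ)); last first.
  have m1 : measurable_fun setT (fun Q : 'M[R]_n => Q^T *m (delta_mx i 0 : 'cV[R]_n)).
    apply: measurable_mulmx; last exact: measurable_cst.
    exact: measurable_trmx.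
  by rewrite -[X in measurable X]setTI; exact: m1.
congr (m _); apply/seteqP; split => S /=; rewrite trmx_mul trmxK mulmxA//.
Qed.

(* Averaging [u A] over the rotations of [A] and exchanging the integrals. *)
Lemma uniform_sphereE (u : probability 'cV[R]_n R) i (A : set 'cV[R]_n) :
  uniform_sphere u -> measurable A -> u A = rot A (delta_mx i 0).
Proof.
move=> [u1 uinv] mA; have [m1 minv] := haar.
pose B := [set z : 'cV[R]_n * 'M[R]_n | A (z.2^T *m z.1)].
have mB : measurable B by rewrite -[X in measurable X]setTI; exact: mrot.
(* Constancy on a set of full measure is enough, as [m] and [u] live on all matrices and all
   vectors. *)
have full d (T : measurableType d) (p : probability T R) (O : set T) f (c : \bar R) :
    measurable O -> p O = 1%E -> measurable_fun setT f ->
    (forall x, O x -> f x = c) -> (\int[p]_x f x = c)%E.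
  move=> mO pO mf fc; transitivity (\int[p]_x (cst c) x)%E.
    apply: ae_eq_integral => //; exists (~` O); split; first exact: measurableC.
      by rewrite [LHS]probability_setC// pO subee.
    by move=> x /=; apply: contra_not => Ox _; exact: fc.
  by rewrite integral_cst// [X in (_ * X)%E]probability_setT mule1.
have E : (\int[m]_Q \int[u]_x (\1_B (x, Q))%:E =
          \int[u]_x \int[m]_Q (\1_B (x, Q))%:E)%E.
  rewrite -(fubini_tonelli (fun z => (\1_B z)%:E))//.
  by apply/measurable_EFinP; exact: measurable_indic.
have h1 : (\int[m]_Q \int[u]_x (\1_B (x, Q))%:E = u A)%E.
  apply: (full _ _ _ (@orthogonal_group R n)) => //.
  - exact: measurable_orthogonal_group.
  - exact: (indic_measurable_fun_fubini_tonelli_G u mB).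
  - move=> Q oQ; rewrite -(uinv Q^T)//; last exact: orthogonal_group_tr.
    transitivity (\int[u]_x (\1_(mulmx Q^T @^-1` A) x)%:E)%E; first by [].
    rewrite integral_indic// ?setIT// -[X in measurable X]setTI.
    have mQ : measurable_fun setT (mulmx Q^T : 'cV[R]_n -> 'cV[R]_n).
      by apply: measurable_mulmx => //; exact: measurable_cst.
    exact: mQ.
have h2 : (\int[u]_x \int[m]_Q (\1_B (x, Q))%:E)%E = rot A (delta_mx i 0).
  apply: (full _ _ _ (@unit_sphere R n)) => //.
  - exact: measurable_unit_sphere.
  - exact: (indic_measurable_fun_fubini_tonelli_F m mB).
  - move=> x x1; rewrite -(rotE i mA x1).
    transitivity (\int[m]_Q (\1_[set Q | A (Q^T *m x)] Q)%:E)%E; first by [].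
    rewrite integral_indic// ?setIT// -[X in measurable X]setTI.
    have mQ : measurable_fun setT (fun Q : 'M[R]_n => Q^T *m x).
      by apply: measurable_mulmx; [exact: measurable_trmx|exact: measurable_cst].
    exact: mQ.
by rewrite -h1 E h2.
Qed.

(** As the i-th column of Q S is Q times that of S, the law of the column is itself a uniform
    measure on the sphere; [uniform_sphereE] then gives it and [u] the same values. *)
Lemma uniform_sphere_col (u : probability 'cV[R]_n R) i :
  uniform_sphere u -> is_law m (col i) u.
Proof.
move=> uu; have mcol : measurable_fun setT (col i : 'M[R]_n -> 'cV[R]_n).
  exact: measurable_col.
split => // A mA.
pose f : {RV m >-> 'cV[R]_n} := mfun_Sub (mem_set mcol).
have [m1 minv] := haar.
have mS (B : set 'cV[R]_n) : measurable B -> measurable (col i @^-1` B : set 'M[R]_n).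
  by move=> mB; rewrite -[X in measurable X]setTI; exact: (mcol measurableT).
have uf : uniform_sphere (distribution m f).
  split.
    apply/eqP; rewrite eq_le probability_le1 ?andTb; last exact: measurable_unit_sphere.
    rewrite -[leLHS]m1; apply: le_measure; rewrite ?inE.
    - exact: measurable_orthogonal_group.
    - by apply: mS; exact: measurable_unit_sphere.
    - by move=> Q; exact: col_orthogonal.
  move=> Q B oQ mB; rewrite -[RHS](minv Q _ oQ (mS B mB)).
  rewrite /pushforward /distribution /pushforward; congr (m _).
  by apply/seteqP; split => S /=; rewrite !colE mulmxA.
by rewrite (uniform_sphereE i uu mA) -(uniform_sphereE i uf mA).
Qed.

End uniform_sphere_law.
End orthogonal_invariance.

(** * Wasserstein distance to scaled and translated measures *)

Section wasserstein_formulas.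
Context {R : realType}.

Lemma Lnorm2E d (T : measurableType d) (m : probability T R) (f : T -> R) :
  sqintegrable m f ->
  ('N[m]_2%:E [(fun x => (f x)%:E)] = (Num.sqrt (\int[m]_x f x ^+ 2))%:E)%E.
Proof.
move=> [mf f2]; rewrite unlock /=.
have -> : (\int[m]_x (`|(f x)%:E| `^ 2) = \int[m]_x (f x ^+ 2)%:E)%E.
  apply: eq_integral => x _.
  by rewrite abse_EFin poweR_EFin powR_mulrn// real_normK// num_real.
by rewrite EFin_Rintegral// poweR_EFin powR12_sqrt// Rintegral_ge0// => x _; exact: sqr_ge0.
Qed.

(** Converts an infimum of distances into a supremum of correlations when neither is known to be
    attained. *)
Lemma ereal_inf_sqrt (D : set R) q k : D !=set0 -> has_ubound D -> 0 < k ->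
  ereal_inf [set (Num.sqrt (q - k * d))%:E | d in D] =
  (Num.sqrt (q - k * sup D))%:E.
Proof.
move=> D0 ubD k0; apply/eqP; rewrite eq_le; apply/andP; split; last first.
  apply: le_ereal_inf_tmp => _ [d Dd <-]; rewrite lee_fin ler_wsqrtr//.
  by rewrite lerD2l lerN2 ler_pM2l// ub_le_sup.
rewrite leNgt; apply/negP; set L := ereal_inf _ => ltL.
have lbL : lbound [set (Num.sqrt (q - k * d))%:E | d in D] L by exact: ereal_inf_lbound.
have [d0 Dd0] := D0.
have : (L <= (Num.sqrt (q - k * d0))%:E)%E by apply: lbL; exists d0.
move: ltL lbL; case: L => [l| |]; [|by rewrite leye_eq|by rewrite ltNge leNye].
rewrite lte_fin => ltl lbL _.
(* Positivity of l forces every radicand to be positive, so that squaring is legitimate although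
   [Num.sqrt] is 0 on negative numbers. *)
have l0 : 0 < l by rewrite (le_lt_trans _ ltl)// sqrtr_ge0.
have lD d : D d -> l ^+ 2 <= q - k * d.
  move=> Dd; have : (l%:E <= (Num.sqrt (q - k * d))%:E)%E by apply: lbL; exists d.
  rewrite lee_fin => h.
  have : 0 < Num.sqrt (q - k * d) by exact: lt_le_trans h.
  rewrite sqrtr_gt0 => qd; rewrite -[leRHS]sqr_sqrtr ?(ltW qd)//.
  by apply: lerXn2r; rewrite ?nnegrE ?sqrtr_ge0 ?(ltW l0).
have supD : sup D <= (q - l ^+ 2) / k.
  apply: ge_sup => // d /lD h; rewrite ler_pdivlMr//.
  by rewrite mulrC; lra.
move: ltl; rewrite ltNge => /negP; apply.
rewrite -[l]ger0_norm ?(ltW l0)// -sqrtr_sqr ler_wsqrtr//.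
by move: supD; rewrite ler_pdivlMr// mulrC => h; lra.
Qed.

End wasserstein_formulas.

Section euclidean_moments.
Context {R : realType} {n : nat}.
Implicit Types sigma eta : probability 'cV[R]_n R.

Definition mean sigma : 'cV[R]_n := vmean sigma id.
Definition mom2 sigma : R := \int[sigma]_x dot x x.
Definition var sigma : R := mom2 sigma - dot (mean sigma) (mean sigma).

Lemma W2_rintegrable sigma : W2_space sigma -> rintegrable sigma (fun x => dot x x).
Proof.
rewrite /W2_space /second_moment => h; apply: ge0_rintegrable.
- exact: measurable_dot.
- exact: dot_ge0.
- by under eq_integral do rewrite -enorm_sqr.
Qed.

Lemma second_momentE sigma : W2_space sigma -> second_moment sigma = (mom2 sigma)%:E.
Proof.
move=> /W2_rintegrable h; rewrite -EFin_Rintegral//.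
by apply: eq_integral => x _; rewrite enorm_sqr.
Qed.

Lemma W2_coord sigma i : W2_space sigma -> sqintegrable sigma (fun x => x i 0).
Proof.
move=> h; split; first exact: measurable_mx_entry.
apply: le_rintegrable (W2_rintegrable h).
  by apply: measurable_funX; exact: measurable_mx_entry.
move=> x; rewrite ger0_norm ?sqr_ge0// /dot (bigD1 i)//= expr2 lerDl.
by apply: sumr_ge0 => j _; rewrite -expr2 sqr_ge0.
Qed.

Lemma W2_dot sigma (b : 'cV[R]_n) : W2_space sigma ->
  sqintegrable sigma (fun x => dot x b).
Proof.
move=> h; apply: sqintegrable_sum => i.
under [X in sqintegrable _ X]eq_fun do rewrite mulrC.
by apply: sqintegrableZ; exact: W2_coord.
Qed.

Lemma Rintegral_dot d (T : measurableType d) (m : probability T R)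
    (F : T -> 'cV[R]_n) (b : 'cV[R]_n) : (forall i, rintegrable m (fun t => F t i 0)) ->
  \int[m]_t dot (F t) b = dot (vmean m F) b.
Proof.
move=> iF; rewrite Rintegral_sum.
  apply: eq_bigr => i _; rewrite mxE mulrC -Rintegral_scale//.
  by apply: eq_Rintegral => t _; rewrite mulrC.
by move=> i; under [X in rintegrable _ X]eq_fun do rewrite mulrC; exact: rintegrableZ.
Qed.

Lemma W2_mean_dot sigma (b : 'cV[R]_n) : W2_space sigma ->
  \int[sigma]_x dot x b = dot (mean sigma) b.
Proof.
move=> h; rewrite Rintegral_dot// => i.
exact: sqintegrable_rintegrable (W2_coord i h).
Qed.

Lemma W2_centered sigma : W2_space sigma ->
  rintegrable sigma (fun x => dot (x - mean sigma) (x - mean sigma)).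
Proof.
move=> h.
have i j : sqintegrable sigma (fun x => (x - mean sigma) j 0).
  have -> : (fun x => (x - mean sigma) j 0) = (fun x => x j 0 - mean sigma j 0).
    by apply/funext => x; rewrite !mxE.
  by apply: sqintegrableB; [exact: W2_coord|exact: sqintegrable_cst].
by apply: rintegrable_sum => j; exact: sqintegrable_mul.
Qed.

Lemma varE sigma : W2_space sigma ->
  var sigma = \int[sigma]_x dot (x - mean sigma) (x - mean sigma).
Proof.
move=> h; have i1 := W2_rintegrable h.
have i2 := sqintegrable_rintegrable (W2_dot (mean sigma) h).
transitivity (\int[sigma]_x
    (dot x x - 2 * dot x (mean sigma) + dot (mean sigma) (mean sigma))).
  rewrite Rintegral_add ?Rintegral_sub ?Rintegral_scale ?Rintegral_cst1//.
  - by rewrite W2_mean_dot// /var /mom2; ring.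
  - exact: rintegrableZ.
  - by apply: rintegrableB => //; exact: rintegrableZ.
  - exact: rintegrable_cst.
by apply: eq_Rintegral => x _; rewrite dotBl !dotBr (dotC (mean sigma) x); ring.
Qed.

Lemma var_ge0 sigma : W2_space sigma -> 0 <= var sigma.
Proof. by move=> h; rewrite varE// Rintegral_ge0// => x _; exact: dot_ge0. Qed.

End euclidean_moments.

(** * Couplings and their correlations *)

Section couplings_theory.
Context {R : realType} {n : nat}.
Variables (sigma eta : probability 'cV[R]_n R).
Hypotheses (sigma2 : W2_space sigma) (eta2 : W2_space eta).
Local Notation E := ('cV[R]_n).

Definition correlations : set R :=
  [set \int[pi]_z dot z.1 z.2 | pi in couplings sigma eta].

(** The quantity c(eta) of the overview: the product of the means is common to all couplings and can
    be subtracted outside the supremum. *)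
Definition covmax := sup correlations - dot (mean sigma) (mean eta).

Section coupling.
Variables (pi : probability (E * E)%type R) (cpi : couplings sigma eta pi).

Lemma coupling_fst : is_law pi fst sigma.
Proof. by split => // A /cpi[]. Qed.

Lemma coupling_snd : is_law pi snd eta.
Proof. by split => // A /cpi[]. Qed.

Lemma coupling_fst_dot b : sqintegrable pi (fun z => dot z.1 b).
Proof. exact: (law_sqintegrable coupling_fst (W2_dot b sigma2)). Qed.

Lemma coupling_snd_dot b : sqintegrable pi (fun z => dot z.2 b).
Proof. exact: (law_sqintegrable coupling_snd (W2_dot b eta2)). Qed.

Lemma coupling_dot : rintegrable pi (fun z => dot z.1 z.2).
Proof.
apply: rintegrable_sum => i; apply: sqintegrable_mul.
  exact: (law_sqintegrable coupling_fst (W2_coord i sigma2)).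
exact: (law_sqintegrable coupling_snd (W2_coord i eta2)).
Qed.

(** Only the last term depends on the coupling, with coefficient -2a: for a > 0 a smaller cost means
    a larger correlation. *)
Lemma coupling_affine_cost (a : R) (b : E) :
  sqintegrable pi (fun z => enorm (a *: z.1 + b - z.2)) /\
  \int[pi]_z enorm (a *: z.1 + b - z.2) ^+ 2 =
  a ^+ 2 * mom2 sigma + mom2 eta + dot b b + 2 * a * dot (mean sigma) b
  - 2 * dot (mean eta) b - 2 * a * \int[pi]_z dot z.1 z.2.
Proof.
have i1 := law_rintegrable coupling_fst (W2_rintegrable sigma2).
have i2 := law_rintegrable coupling_snd (W2_rintegrable eta2).
have i3 := sqintegrable_rintegrable (coupling_fst_dot b).
have i4 := sqintegrable_rintegrable (coupling_snd_dot b).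
have i5 := coupling_dot.
have e z : enorm (a *: z.1 + b - z.2) ^+ 2 =
    a ^+ 2 * dot z.1 z.1 + dot z.2 z.2 + dot b b + 2 * a * dot z.1 b
    - 2 * dot z.2 b - 2 * a * dot z.1 z.2.
  rewrite enormB_sqr !dotDl !dotDr !dotZl !dotZr (dotC b z.1) (dotC b z.2); ring.
have j1 := rintegrableZ (a ^+ 2) i1.
have j2 := rintegrableD j1 i2.
have j3 := rintegrableD j2 (rintegrable_cst pi (dot b b)).
have k3 := rintegrableZ (2 * a) i3.
have j4 := rintegrableD j3 k3.
have k4 := rintegrableZ 2 i4.
have j5 := rintegrableB j4 k4.
have k5 := rintegrableZ (2 * a) i5.
have j6 := rintegrableB j5 k5.
split; last first.
  under eq_Rintegral do rewrite e.
  rewrite Rintegral_sub// Rintegral_sub// Rintegral_add// Rintegral_add//;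
    last exact: rintegrable_cst.
  rewrite Rintegral_add// !Rintegral_scale// Rintegral_cst1.
  rewrite -(law_Rintegral coupling_fst (W2_rintegrable sigma2)).
  rewrite -(law_Rintegral coupling_snd (W2_rintegrable eta2)).
  rewrite -(law_Rintegral coupling_fst (sqintegrable_rintegrable (W2_dot b sigma2))).
  rewrite -(law_Rintegral coupling_snd (sqintegrable_rintegrable (W2_dot b eta2))).
  by rewrite !W2_mean_dot.
split; last by under [X in rintegrable _ X]eq_fun do rewrite e.
apply: measurable_enorm; apply: measurable_sub_mx => //.
apply: measurable_add_mx; last exact: measurable_cst.
by apply: measurable_scale_mx => //; exact: measurable_cst.
Qed.

End coupling.
End couplings_theory.
Section product_coupling.
Context {R : realType} {n : nat}.
Implicit Types sigma eta : probability 'cV[R]_n R.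

Lemma product_couplings sigma eta : couplings sigma eta (sigma \x eta)%E.
Proof.
move=> A mA; rewrite /pushforward; split.
  rewrite -setXT [LHS]product_measure1E//.
  by rewrite [X in (_ * X)%E]probability_setT mule1.
rewrite -setTX [LHS]product_measure1E//.
by rewrite [X in (X * _)%E]probability_setT mul1e.
Qed.

Lemma product_Rintegral d1 (T1 : measurableType d1) (P : probability T1 R)
    d2 (T2 : measurableType d2) (Q : probability T2 R) f g :
  rintegrable (P \x Q)%E (fun z : T1 * T2 => f z.1 * g z.2) ->
  rintegrable P f -> rintegrable Q g ->
  \int[(P \x Q)%E]_z (f z.1 * g z.2) = (\int[P]_x f x) * (\int[Q]_y g y).
Proof.
move=> ifg if_ ig; apply: EFin_inj; rewrite -EFin_Rintegral//.
rewrite -(@integral12_prod_meas1 _ _ _ _ _ P Q (EFin \o (fun z => f z.1 * g z.2)))//.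
transitivity (\int[P]_x ((\int[Q]_y g y)%:E * (f x)%:E))%E.
  apply: eq_integral => x _; rewrite /fubini_F /= -EFin_Rintegral// muleC.
  by rewrite -(integralZl measurableT ig); apply: eq_integral => y _; rewrite EFinM.
by rewrite (integralZl measurableT if_) [X in (_ * X)%E]EFin_Rintegral// -EFinM mulrC.
Qed.

End product_coupling.

Section affine_cost.
Context {R : realType} {n : nat}.
Variables (sigma eta : probability 'cV[R]_n R).
Hypotheses (sigma2 : W2_space sigma) (eta2 : W2_space eta).
Local Notation E := ('cV[R]_n).

Lemma correlations_neq0 : correlations sigma eta !=set0.
Proof. by eexists; exists (sigma \x eta)%E => //; exact: product_couplings. Qed.

Lemma mean_dot_correlations : correlations sigma eta (dot (mean sigma) (mean eta)).
Proof.
exists (sigma \x eta)%E; first exact: product_couplings.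
have c := product_couplings sigma eta.
have i1 i := law_sqintegrable (coupling_fst c) (W2_coord i sigma2).
have i2 i := law_sqintegrable (coupling_snd c) (W2_coord i eta2).
rewrite Rintegral_sum; last by move=> i; exact: sqintegrable_mul.
apply: eq_bigr => i _; rewrite !mxE.
rewrite (@product_Rintegral _ _ _ _ _ _ _ (fun x : E => x i 0) (fun x : E => x i 0))//.
- exact: sqintegrable_mul.
- exact: sqintegrable_rintegrable (W2_coord i sigma2).
- exact: sqintegrable_rintegrable (W2_coord i eta2).
Qed.

(** Nonnegativity of the cost at a = 1, b = 0, for every coupling. *)
Lemma correlations_ubound : has_ubound (correlations sigma eta).
Proof.
exists ((mom2 sigma + mom2 eta) / 2) => _ [pi c <-].
have [_] := coupling_affine_cost sigma2 eta2 c 1 0.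
set s := \int[pi]_z dot z.1 z.2.
have : 0 <= \int[pi]_x enorm (1 *: x.1 + 0 - x.2) ^+ 2.
  by apply: Rintegral_ge0 => x _; exact: sqr_ge0.
move=> + h; rewrite h expr1n mul1r -(scale0r (0 : E)) !dotZr.
lra.
Qed.

Lemma covmax_ge0 : 0 <= covmax sigma eta.
Proof.
rewrite subr_ge0 ub_le_sup//; first exact: correlations_ubound.
exact: mean_dot_correlations.
Qed.

(** The infimum over couplings of the cost in [coupling_affine_cost], in centred moments, so that b
    occurs only in the squared distance of the means. *)
Definition affine_cost (a : R) (b : E) : R :=
  dot (a *: mean sigma + b - mean eta) (a *: mean sigma + b - mean eta) +
  a ^+ 2 * var sigma + var eta - 2 * a * covmax sigma eta.

Let base (a : R) b := a ^+ 2 * mom2 sigma + mom2 eta + dot b b +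
  2 * a * dot (mean sigma) b - 2 * dot (mean eta) b.

Let affine_costE a b :
  affine_cost a b = base a b - 2 * a * sup (correlations sigma eta).
Proof.
rewrite /affine_cost /base /covmax /var dotBl !dotBr !dotDl !dotDr !dotZl !dotZr.
rewrite (dotC b (mean sigma)) (dotC (mean eta) (mean sigma)) (dotC b (mean eta)).
by ring.
Qed.

(** The map S(x) = a x + b is invertible, so acting by S or its inverse on the first factor
    exchanges the couplings of sigma and eta with those of the image of sigma and eta. *)
Lemma W2_affine (a : R) (b : E) : 0 < a ->
  W2 (pushforward sigma (fun x => a *: x + b)) eta =
  (Num.sqrt (affine_cost a b))%:E.
Proof.
move=> a0; rewrite affine_costE -ereal_inf_sqrt; last 3 first.
- exact: correlations_neq0.
- exact: correlations_ubound.
- by rewrite mulr_gt0.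
have a1 : a != 0 by rewrite gt_eqF.
pose S (x : E) := a *: x + b.
pose S' (x : E) := a^-1 *: (x - b).
have SK x : S (S' x) = x by rewrite /S /S' scalerA divff// scale1r subrK.
have S'K x : S' (S x) = x by rewrite /S /S' addrK scalerA mulVf// scale1r.
have mS : measurable_fun setT S.
  apply: measurable_add_mx; last exact: measurable_cst.
  by apply: measurable_scale_mx => //; exact: measurable_cst.
have mS' : measurable_fun setT S'.
  apply: measurable_scale_mx; first exact: measurable_cst.
  by apply: measurable_sub_mx => //; exact: measurable_cst.
have cost pi : couplings sigma eta pi ->
    ('N[pi]_2%:E [(fun z => (enorm (S z.1 - z.2))%:E)] =
     (Num.sqrt (base a b - 2 * a * \int[pi]_z dot z.1 z.2))%:E)%E.
  move=> c; have [i1 e1] := coupling_affine_cost sigma2 eta2 c a b.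
  by rewrite (@Lnorm2E _ _ _ pi (fun z => enorm (S z.1 - z.2)))// e1.
pose tensor (f : E -> E) (z : E * E) := (f z.1, z.2).
have mtensor f : measurable_fun setT f -> measurable_fun setT (tensor f).
  by move=> mf; apply/measurable_fun_pairP; split;
    [exact: (measurableT_comp mf measurable_fst)|exact: measurable_snd].
(* Transport of a coupling and of its L2 norms by a map of the first factor; used once with S' and
   once with S. *)
have image (pi : probability (E * E)%type R) f (mf : measurable_fun setT f) :
    exists gamma : probability (E * E)%type R,
      (forall A, gamma A = pi (tensor f @^-1` A)) /\
      (forall h : E * E -> R, measurable_fun setT h ->
        'N[gamma]_2%:E [EFin \o h] = 'N[pi]_2%:E [EFin \o (h \o tensor f)])%E.
  pose F : {RV pi >-> (E * E)%type} := mfun_Sub (mem_set (mtensor f mf)).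
  exists (distribution pi F); split => // h mh.
  rewrite unlock; congr (_ `^ _)%E.
  rewrite ge0_integral_distribution//.
  - apply: (measurableT_comp (measurable_poweR _)).
    by apply: measurableT_comp => //; exact: measurableT_comp.
  - by move=> x; exact: poweR_ge0.
have mdist : measurable_fun setT (fun z : E * E => enorm (z.1 - z.2)).
  by apply: measurable_enorm; exact: measurable_sub_mx.
congr ereal_inf; apply/seteqP; split => [_ [gamma c <-]|_ [_ [pi c <-] <-]].
  have [pi [piE piN]] := image gamma S' mS'.
  have cpi : couplings sigma eta pi.
    move=> A mA; have mSA : measurable (S' @^-1` A).
      by rewrite -[X in measurable X]setTI; exact: mS'.
    have [c1 _] := c _ mSA; have [_ c2] := c _ mA.
    rewrite /pushforward !piE; split; last exact: c2.
    rewrite [LHS]c1 /pushforward; congr (sigma _).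
    by apply/seteqP; split => x /=; rewrite S'K.
  exists (\int[pi]_z dot z.1 z.2); first by exists pi.
  rewrite -cost// (piN (fun z => enorm (S z.1 - z.2))).
    by congr ('N[gamma]_2%:E [_])%E; apply/funext => z /=; rewrite SK.
  by apply: measurable_enorm; apply: measurable_sub_mx => //; exact: measurableT_comp.
have [gamma [gammaE gammaN]] := image pi S mS.
exists gamma; last by rewrite -cost// (gammaN (fun z => enorm (z.1 - z.2))).
move=> A mA; have mSA : measurable (S @^-1` A).
  by rewrite -[X in measurable X]setTI; exact: mS.
have [c1 _] := c _ mSA; have [_ c2] := c _ mA.
by rewrite /pushforward !gammaE; split; [exact: c1|exact: c2].
Qed.

Lemma W2E : W2 sigma eta = (Num.sqrt (affine_cost 1 0))%:E.
Proof.
rewrite -W2_affine//; congr (W2 _ eta); apply/funext => A.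
by rewrite /pushforward; congr (sigma _); apply/seteqP; split => x /=;
  rewrite scale1r addr0.
Qed.

End affine_cost.

(** * Optimal scale-translations *)

Section optimal_scaling.
Context {R : realType} {n : nat}.
Variables (sigma eta : probability 'cV[R]_n R).
Hypotheses (sigma2 : W2_space sigma) (eta2 : W2_space eta).
Hypothesis var_gt0 : 0 < var sigma.
Local Notation E := ('cV[R]_n).
Local Notation c := (covmax sigma eta).
Local Notation cost := (affine_cost sigma eta).

(** As [Num.sqrt] vanishes on negative numbers, distances determine costs only once this is
    known. *)
Lemma affine_cost_ge0 a b : 0 < a -> 0 <= cost a b.
Proof.
move=> a0; have a20 : 0 < 2 * a by rewrite mulr_gt0.
suff : sup (correlations sigma eta) <= (cost a b +
    2 * a * sup (correlations sigma eta)) / (2 * a).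
  by rewrite ler_pdivlMr// mulrC => h; lra.
apply: ge_sup; first exact: correlations_neq0.
move=> _ [pi cpi <-]; rewrite ler_pdivlMr//.
have [_] := coupling_affine_cost sigma2 eta2 cpi a b.
have : 0 <= \int[pi]_x enorm (a *: x.1 + b - x.2) ^+ 2.
  by apply: Rintegral_ge0 => x _; exact: sqr_ge0.
move: (\int[pi]_x _) => I I0 IE.
rewrite /affine_cost /covmax /var dotBl !dotBr !dotDl !dotDr !dotZl !dotZr.
rewrite (dotC b (mean sigma)) (dotC (mean eta) (mean sigma)) (dotC b (mean eta)).
lra.
Qed.

Let opt_a := c / var sigma.
Let opt_b := mean eta - opt_a *: mean sigma.

(** Completing the square in a. Both excess terms are nonnegative, and they vanish together only at
    ([opt_a], [opt_b]). *)
Let cost_opt a b : cost a b = cost opt_a opt_b +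
  dot (a *: mean sigma + b - mean eta) (a *: mean sigma + b - mean eta) +
  var sigma * (a - opt_a) ^+ 2.
Proof.
rewrite /affine_cost /opt_b (addrC (opt_a *: _)) subrK subrr.
rewrite dot0l /opt_a; set D := dot (a *: _ + _ - _) _.
by field; rewrite gt_eqF.
Qed.

Lemma argmin_W2_affine a b : 0 < a ->
  argmin_W2 sigma eta (fun x => a *: x + b) <->
  forall a' b', 0 < a' -> cost a b <= cost a' b'.
Proof.
move=> a0; split => [[_ h] a' b' a'0|h].
  have := h (fun x => a' *: x + b') (ex_intro _ a' (ex_intro _ b' (conj a'0 erefl))).
  rewrite !W2_affine// lee_fin; apply: contraTT; rewrite -!ltNge => lt.
  by rewrite ltr_sqrt// (le_lt_trans _ lt)// affine_cost_ge0.
split; first by exists a, b.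
move=> _ [a' [b' [a'0 ->]]].
by rewrite !W2_affine// lee_fin ler_wsqrtr// h.
Qed.

Lemma opt_S_gt0 : 0 < c ->
  opt_S sigma eta = (fun x => (c / var sigma) *: (x - mean sigma) + mean eta).
Proof.
move=> c0; have a0 : 0 < opt_a by rewrite divr_gt0.
have -> : (fun x => (c / var sigma) *: (x - mean sigma) + mean eta) =
    (fun x => opt_a *: x + opt_b).
  by apply/funext => x; rewrite scalerBr -/opt_a /opt_b -addrA (addrC (- _)).
apply: xget_unique.
  apply/argmin_W2_affine => // a b _; rewrite (cost_opt a b) -addrA lerDl.
  by rewrite addr_ge0 ?dot_ge0// mulr_ge0 ?sqr_ge0 ?ltW.
move=> S Smin; have [[a [b [a'0 SE]]] _] := Smin; move: Smin; rewrite SE.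
move=> /(argmin_W2_affine _ a'0)/(_ _ opt_b a0).
(* Minimality leaves no room for the two excess terms of [cost_opt]: the square fixes a, then the
   distance of the means fixes b. *)
rewrite (cost_opt a b) -addrA gerDl.
set D := dot _ _ => h.
have D0 : 0 <= D by exact: dot_ge0.
have V0 : 0 <= var sigma * (a - opt_a) ^+ 2 by rewrite mulr_ge0 ?sqr_ge0 ?ltW.
have /eqP : var sigma * (a - opt_a) ^+ 2 = 0 by lra.
rewrite mulf_eq0 gt_eqF//= sqrf_eq0 subr_eq0 => /eqP ea.
have /eqP : D = 0 by lra.
rewrite dot_eq0 subr_eq0 => /eqP eb.
by rewrite /opt_b -eb ea addrC addKr.
Qed.

(** Halving the slope and matching the means strictly lowers the cost when c <= 0, so there is no
    minimiser and [xget] returns its default. *)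
Lemma opt_S_le0 : c <= 0 -> opt_S sigma eta = id.
Proof.
move=> c0; apply: xgetPN => S; rewrite -/(argmin_W2 _ _ _) => Smin.
have [[a [b [a0 SE]]] _] := Smin; move: Smin; rewrite SE.
move=> /(argmin_W2_affine _ a0).
move=> /(_ (a / 2) (mean eta - (a / 2) *: mean sigma)).
rewrite /affine_cost (addrC ((a / 2) *: _)) subrK subrr dot0l.
have /[swap] /[apply] : 0 < a / 2 by lra.
have := dot_ge0 (a *: mean sigma + b - mean eta).
set D := dot _ _ => D0.
have : 0 < a ^+ 2 * var sigma by rewrite mulr_gt0 ?exprn_gt0.
have : 0 <= - (a * c) by rewrite oppr_ge0 mulr_ge0_le0// ltW.
rewrite expr_div_n mulrAC.
move: (a ^+ 2 * var sigma) => Z; rewrite (mulrAC 2 _ _ ).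
by lra.
Qed.

Lemma L2norm_centered k :
  L2norm sigma (fun x => k *: (x - mean sigma)) = (`|k| * Num.sqrt (var sigma))%:E.
Proof.
have e x : enorm (k *: (x - mean sigma)) ^+ 2 =
    k ^+ 2 * dot (x - mean sigma) (x - mean sigma).
  by rewrite enorm_sqr dotZl dotZr expr2 mulrA.
have i := W2_centered sigma2.
rewrite /L2norm (@Lnorm2E _ _ _ sigma (fun x => enorm (k *: (x - mean sigma)))).
  under eq_Rintegral do rewrite e.
  by rewrite Rintegral_scale// -varE// sqrtrM ?sqr_ge0// sqrtr_sqr.
split; last by under [X in rintegrable _ X]eq_fun do rewrite e; exact: rintegrableZ.
apply: measurable_enorm; apply: measurable_scale_mx; first exact: measurable_cst.
by apply: measurable_sub_mx => //; exact: measurable_cst.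
Qed.

End optimal_scaling.

(** * Couplings with positive covariance *)

Section density.
Context d (T : measurableType d) {R : realType} (rho : probability T R).
Variable h : T -> R.
Hypotheses (h0 : forall x, 0 <= h x) (ih : rintegrable rho h).
Hypothesis h1 : \int[rho]_x h x = 1.

Let mh : measurable_fun setT h. Proof. exact: rintegrable_measurable ih. Qed.

Lemma density_probability : exists pi : probability T R,
  forall A, measurable A -> pi A = (\int[rho]_(x in A) (h x)%:E)%E.
Proof.
pose f A := (\int[rho]_(x in A) (h x)%:E)%E.
have f0 : f set0 = 0%E by rewrite /f integral_set0.
have f_ge0 A : (0 <= f A)%E by apply: integral_ge0 => x _; rewrite lee_fin.
have f_sigma : semi_sigma_additive f.
  move=> F mF tF mUF; rewrite /f ge0_integral_bigcup//.
  - apply: is_cvg_ereal_nneg_natsum_cond => i _ _.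
    by apply: integral_ge0 => x _; rewrite lee_fin.
  - by apply: measurable_funTS; exact/measurable_EFinP.
  - by move=> x _; rewrite lee_fin.
pose mix1 := isMeasure.Build _ _ _ f f0 f_ge0 f_sigma.
pose mu : {measure set T -> \bar R} := HB.pack f mix1.
have muT : mu setT = 1%E by rewrite /mu /= /f EFin_Rintegral// h1.
pose mix2 := Measure_isProbability.Build _ _ _ mu muT.
pose pi : probability T R := HB.pack f mix1 mix2.
by exists pi.
Qed.

Variable pi : probability T R.
Hypothesis piE : forall A, measurable A -> pi A = (\int[rho]_(x in A) (h x)%:E)%E.

(** By the layer-cake formula both sides are integrals over t of the measures of the sets k > t,
    where [piE] applies. *)
Lemma density_ge0_integral (k : T -> R) : measurable_fun setT k ->
  (forall x, 0 <= k x) ->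
  (\int[pi]_x (k x)%:E = \int[rho]_x (h x * k x)%:E)%E.
Proof.
move=> mk k0.
under eq_integral do rewrite -[k _]mul1r.
rewrite !layer_cake//.
apply: eq_integral => t _.
under eq_integral do rewrite mul1r.
have mL : measurable (k @^-1` [set y | 0 <= t < y]).
  rewrite -[X in measurable X]setTI.
  have := @measurable_layer R _ T k (fun=> t) mk (measurable_cst _).
  move=> /(_ measurableT [set 1] (measurable_set1 _)).
  congr (measurable (_ `&` _)); apply/seteqP; split => x; rewrite /layer /= indicE.
    by case: (boolP (t \in _)) => [/set_mem /=|_ /esym/eqP]; rewrite ?in_itv ?oner_eq0.
  by move=> tx; rewrite mem_set//= in_itv.
have layerE x : layer t (k x) = \1_(k @^-1` [set y | 0 <= t < y]) x.
  by rewrite /layer !indicE; congr (_%:R); apply: congr1; apply/idP/idP => /set_mem;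
    rewrite /= ?in_itv/= => tx; apply/mem_set; rewrite /= ?in_itv.
under eq_integral do rewrite layerE.
rewrite integral_indic// setIT [LHS]piE// integral_mkcond.
apply: eq_integral => x _; rewrite layerE patchE indicE; case: ifPn => _.
  by rewrite mulr1.
by rewrite mulr0.
Qed.

Lemma density_Rintegral (k : T -> R) : rintegrable pi k ->
  rintegrable rho (fun x => h x * k x) ->
  \int[pi]_x k x = \int[rho]_x (h x * k x).
Proof.
move=> ik ihk; have mk := rintegrable_measurable ik.
pose p x := Num.max (k x) 0; pose q x := Num.max (- k x) 0.
have p0 x : 0 <= p x by rewrite le_max lexx orbT.
have q0 x : 0 <= q x by rewrite le_max lexx orbT.
have pk x : p x <= `|k x| by rewrite ge_max ler_norm normr_ge0.
have qk x : q x <= `|k x| by rewrite ge_max -normrN ler_norm normr_ge0.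
have kE x : k x = p x - q x.
  by rewrite /p /q; case: leP => ?; case: leP => ?; lra.
have mp : measurable_fun setT p by exact: measurable_maxr.
have mq : measurable_fun setT q.
  by apply: measurable_maxr => //; exact: measurableT_comp.
have ak : rintegrable pi (fun x => `|k x|) by exact: integrable_norm.
have ahk : rintegrable rho (fun x => `|h x * k x|) by exact: integrable_norm.
have main (r : T -> R) : measurable_fun setT r -> (forall x, 0 <= r x) ->
    (forall x, r x <= `|k x|) -> [/\ rintegrable pi r,
      rintegrable rho (fun x => h x * r x) &
      \int[pi]_x r x = \int[rho]_x (h x * r x)].
  move=> mr r0 rk.
  have i1 : rintegrable pi r.
    by apply: le_rintegrable ak => // x; rewrite ger0_norm.
  have i2 : rintegrable rho (fun x => h x * r x).
    apply: le_rintegrable ahk; first exact: measurable_funM.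
    by move=> x; rewrite !normrM ler_wpM2l// ger0_norm.
  by split => //; apply: EFin_inj; rewrite -!EFin_Rintegral// density_ge0_integral.
have [ip ihp ep] := main p mp p0 pk.
have [iq ihq eq] := main q mq q0 qk.
transitivity (\int[pi]_x (p x - q x)); first by apply: eq_Rintegral => x _.
rewrite Rintegral_sub// ep eq -Rintegral_sub//.
by apply: eq_Rintegral => x _; rewrite -mulrBr -kE.
Qed.

End density.

(** * Centred indicators of exceeding the mean *)

Section positive_deviation.
Context d (T : measurableType d) {R : realType} (P : probability T R).
Variables (Z : T -> R) (iZ : sqintegrable P Z).
Let z0 := \int[P]_x Z x.

Definition above : set T := [set x | z0 < Z x].

(** Centred and bounded by 1, the two properties required of a factor in the perturbation of the
    product coupling. *)
Definition above_dev x : R := \1_above x - fine (P above).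

Let mZ : measurable_fun setT Z. Proof. by case: iZ. Qed.

Lemma measurable_above : measurable above.
Proof.
rewrite -[X in measurable X]setTI.
exact: (measurable_fun_ltr (measurable_cst _) mZ measurableT).
Qed.

Lemma measurable_above_dev : measurable_fun setT above_dev.
Proof. 
apply: measurable_funB; last exact: measurable_cst.
exact: (measurable_indic measurable_above).
Qed.

Lemma above_dev_le1 x : `|above_dev x| <= 1.
Proof.
have /fineK e := fin_num_measure P _ measurable_above.
have p0 : 0 <= fine (P above) by rewrite -lee_fin e.
have p1 : fine (P above) <= 1.
  by rewrite -lee_fin e; exact: (probability_le1 P measurable_above).
by rewrite /above_dev indicE ler_norml; case: (x \in _) => /=; lra.
Qed.

Lemma Rintegral_above_dev : \int[P]_x above_dev x = 0.
Proof.
have i : rintegrable P (\1_above : T -> R).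
  by apply: integrable_indic => //; exact: measurable_above.
rewrite Rintegral_sub//; last exact: rintegrable_cst.
rewrite Rintegral_cst1; apply/eqP; rewrite subr_eq0; apply/eqP; congr fine.
by rewrite integral_indic// ?setIT//; exact: measurable_above.
Qed.

(* The covariance of [Z] with the indicator of [Z > E Z] is half of E |Z - E Z|. *)
Lemma above_dev_cov : \int[P]_x (above_dev x * Z x) <= 0 ->
  P [set x | Z x <> z0] = 0%E.
Proof.
move=> le0; have iZ1 := sqintegrable_rintegrable iZ.
have ia : sqintegrable P above_dev.
  apply: (@le_sqintegrable _ _ _ _ _ (fun=> 1)).
  - exact: measurable_above_dev.
  - by move=> x; rewrite normr1 above_dev_le1.
  - exact: sqintegrable_cst.
have i1 := sqintegrable_mul ia iZ.
have i2 := sqintegrable_rintegrable ia.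
have iab : rintegrable P (fun x => `|Z x - z0|).
  by apply: integrable_norm => //; apply: rintegrableB => //; exact: rintegrable_cst.
have e : \int[P]_x `|Z x - z0| = 2 * \int[P]_x (above_dev x * Z x).
  have -> : \int[P]_x (above_dev x * Z x) =
      \int[P]_x (above_dev x * Z x - z0 * above_dev x).
    rewrite Rintegral_sub ?Rintegral_scale//; last exact: rintegrableZ.
    by rewrite Rintegral_above_dev mulr0 subr0.
  have i3 : rintegrable P (fun x => above_dev x * Z x - z0 * above_dev x).
    by apply: rintegrableB => //; exact: rintegrableZ.
  (* With p = P(above), 2 [above_dev] - k is 2(1 - p) - (1 - 2p) = 1 above the mean and -2p - (1 -
     2p) = -1 elsewhere, the sign needed for the absolute value; the k term integrates to 0. *)
  pose k := 1 - 2 * fine (P above).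
  transitivity (\int[P]_x (2 * (above_dev x * Z x - z0 * above_dev x) -
     k * (Z x - z0))); last first.
    rewrite Rintegral_sub; [|exact: rintegrableZ|].
      rewrite !Rintegral_scale//; last by apply: rintegrableB => //; exact: rintegrable_cst.
      rewrite [X in _ - k * X]Rintegral_sub//; last exact: rintegrable_cst.
      by rewrite Rintegral_cst1 subrr mulr0 subr0.
    by apply: rintegrableZ; apply: rintegrableB => //; exact: rintegrable_cst.
  apply: eq_Rintegral => x _; rewrite /above_dev indicE /k.
  have [/set_mem/= zx|] := boolP (x \in above).
    by rewrite gtr0_norm ?subr_gt0//=; ring.
  rewrite notin_setE /= => /negP; rewrite -leNgt => zx.
  by rewrite ler0_norm ?subr_le0//=; ring.
have : (\int[P]_x `|(Z x - z0)%:E| = 0)%E.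
  have h0 : 0 <= \int[P]_x `|Z x - z0| by apply: Rintegral_ge0.
  have /eqP h1 : \int[P]_x `|Z x - z0| == 0 by rewrite eq_le h0 andbT e; lra.
  by rewrite -[RHS]/(0%R%:E) -h1 -EFin_Rintegral.
have mf : measurable_fun setT (fun x => (Z x - z0)%:E).
  by apply/measurable_EFinP; apply: measurable_funB => //; exact: measurable_cst.
move/(ae_eq_integral_abs P measurableT mf) => [N [mN N0 sub]].
apply: (subset_measure0 _ mN _ N0).
  rewrite (_ : [set x | _] = ~` (setT `&` Z @^-1` [set z0])); last by rewrite setTI.
  by apply: measurableC; exact: mZ.
move=> x /= zx; apply: sub => /= /(_ I) [/eqP]; rewrite subr_eq0 => /eqP.
exact: zx.
Qed.

End positive_deviation.

(** * Targets admitting no positive covariance *)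

Section degenerate_target.
Context {R : realType} {n : nat}.
Variables (sigma eta : probability 'cV[R]_n R).
Hypotheses (sigma2 : W2_space sigma) (eta2 : W2_space eta).
Hypothesis hyperplane0 : forall (theta : 'cV[R]_n) r, theta != 0 ->
  sigma [set x | dot x theta = r] = 0%E.
Local Notation E := ('cV[R]_n).

Section perturbation.
Variables (f g : E -> R).
Hypotheses (mf : measurable_fun setT f) (mg : measurable_fun setT g).
Hypotheses (f1 : forall x, `|f x| <= 1) (g1 : forall x, `|g x| <= 1).
Hypotheses (f0 : \int[sigma]_x f x = 0) (g0 : \int[eta]_x g x = 0).

Let rho : probability (E * E)%type R := (sigma \x eta)%E.
Let crho : couplings sigma eta rho := product_couplings sigma eta.
(** A density with respect to the product coupling: nonnegative because |f g| <= 1, and with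
    unchanged marginals because f and g have mean zero. *)
Let h (z : E * E) := 1 + f z.1 * g z.2.

Let fg1 z : `|f z.1 * g z.2| <= 1.
Proof. by rewrite normrM mulr_ile1. Qed.

Let h0 z : 0 <= h z.
Proof. by have := fg1 z; rewrite /h ler_norml => /andP[]; lra. Qed.

Let h2 z : `|h z| <= 2.
Proof. by rewrite ger0_norm//; have := fg1 z; rewrite /h ler_norml => /andP[]; lra. Qed.

Let mfg : measurable_fun setT (fun z : E * E => f z.1 * g z.2).
Proof.
apply: measurable_funM; first exact: (measurableT_comp mf measurable_fst).
exact: (measurableT_comp mg measurable_snd).
Qed.

Let mh : measurable_fun setT h.
Proof. by apply: measurable_funD => //; exact: measurable_cst. Qed.

Let bounded_sq d (T : measurableType d) (P : probability T R) (k : T -> R) :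
  measurable_fun setT k -> (forall x, `|k x| <= 1) -> sqintegrable P k.
Proof.
move=> mk k1; apply: (@le_sqintegrable _ _ _ _ _ (fun=> 1)) => //.
- by move=> x; rewrite normr1.
- exact: sqintegrable_cst.
Qed.

Let ifg : rintegrable rho (fun z => f z.1 * g z.2).
Proof. exact: sqintegrable_rintegrable (bounded_sq rho mfg fg1). Qed.

Let ih : rintegrable rho h.
Proof. by apply: rintegrableD => //; exact: rintegrable_cst. Qed.

Let i_f := bounded_sq sigma mf f1.
Let i_g := bounded_sq eta mg g1.
Let if1 := sqintegrable_rintegrable i_f.
Let ig1 := sqintegrable_rintegrable i_g.

Let h1 : \int[rho]_z h z = 1.
Proof.
rewrite Rintegral_add//; last exact: rintegrable_cst.
by rewrite Rintegral_cst1 product_Rintegral// f0 mul0r addr0.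
Qed.

(** Used on cylinders: there the perturbation restricted to A is still a product of a function of x
    and one of y, and [zero] provides a factor of mean zero. *)
Let marginal (A : set (E * E)) (fA gA : E -> R) : measurable A ->
  measurable_fun setT fA -> measurable_fun setT gA ->
  (forall x, `|fA x| <= 1) -> (forall x, `|gA x| <= 1) ->
  (forall z, \1_A z * (f z.1 * g z.2) = fA z.1 * gA z.2) ->
  \int[sigma]_x fA x = 0 \/ \int[eta]_x gA x = 0 ->
  (\int[rho]_(z in A) (h z)%:E = rho A)%E.
Proof.
move=> mA mfA mgA fA1 gA1 AE zero.
have iA : rintegrable rho (\1_A : _ -> R) by apply: integrable_indic.
have ifA := bounded_sq sigma mfA fA1.
have igA := bounded_sq eta mgA gA1.
have ifgA : rintegrable rho (fun z => fA z.1 * gA z.2).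
  apply: sqintegrable_mul.
    exact: (law_sqintegrable (coupling_fst crho) ifA).
  exact: (law_sqintegrable (coupling_snd crho) igA).
transitivity (\int[rho]_z (\1_A z + fA z.1 * gA z.2)%:E)%E.
  rewrite integral_mkcond; apply: eq_integral => z _.
  rewrite patchE -AE indicE; case: ifPn => _; congr EFin.
    by rewrite mul1r.
  by rewrite mul0r addr0.
rewrite EFin_Rintegral; last exact: rintegrableD.
rewrite Rintegral_add//.
rewrite product_Rintegral//; [|exact: sqintegrable_rintegrable..].
have -> : (\int[sigma]_x fA x) * (\int[eta]_x gA x) = 0.
  by case: zero => ->; rewrite ?mul0r ?mulr0.
by rewrite addr0 -EFin_Rintegral// integral_indic// setIT.
Qed.

Let bounded_indic (A : set E) (k : E -> R) : (forall x, `|k x| <= 1) ->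
  forall x, `|\1_A x * k x| <= 1.
Proof.
move=> k1 x; rewrite normrM mulr_ile1// indicE; case: (_ \in _) => /=.
  by rewrite normr1.
by rewrite normr0.
Qed.

(** The gain, the sum over j of E[f x_j] E[g y_j], is regrouped around the vector w = E[g(y) y], so
    that f can be chosen after w. *)
Lemma perturbed_correlation :
  correlations sigma eta (dot (mean sigma) (mean eta) +
    \int[sigma]_x (f x * dot x (vmean eta (fun y => g y *: y)))).
Proof.
have [pi piE] := density_probability h0 ih h1.
have cpi : couplings sigma eta pi.
  move=> A mA; have [c1 c2] := crho mA.
  have m1 : measurable (fst @^-1` A : set (E * E)).
    by rewrite -[X in measurable X]setTI; exact: measurable_fst.
  have m2 : measurable (snd @^-1` A : set (E * E)).
    by rewrite -[X in measurable X]setTI; exact: measurable_snd.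
  split.
    rewrite -[RHS]c1 /pushforward piE//.
    apply: (@marginal _ (fun x => \1_A x * f x) g) => //.
    - by apply: measurable_funM => //; exact: measurable_indic.
    - exact: bounded_indic.
    - by move=> z; rewrite mulrA.
    - by right.
  rewrite -[RHS]c2 /pushforward piE//.
  apply: (@marginal _ f (fun x => \1_A x * g x)) => //.
  - by apply: measurable_funM => //; exact: measurable_indic.
  - exact: bounded_indic.
  - by move=> z; rewrite mulrCA.
  - by left.
exists pi => //.
have idot := coupling_dot sigma2 eta2 crho.
have ihdot : rintegrable rho (fun z => h z * dot z.1 z.2).
  apply: (@le_rintegrable _ _ _ _ _ (fun z => 2 * `|dot z.1 z.2|)).
  - by apply: measurable_funM => //; exact: rintegrable_measurable idot.
  - by move=> z; rewrite normrM ler_wpM2r.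
  - by apply: rintegrableZ; exact: integrable_norm.
rewrite (density_Rintegral h0 ih piE (coupling_dot sigma2 eta2 cpi) ihdot).
have icoord1 j := law_sqintegrable (coupling_fst crho) (W2_coord j sigma2).
have icoord2 j := law_sqintegrable (coupling_snd crho) (W2_coord j eta2).
have ifx j : rintegrable sigma (fun x => f x * x j 0).
  by apply: sqintegrable_mul => //; exact: W2_coord.
have igy j : rintegrable eta (fun y => g y * y j 0).
  by apply: sqintegrable_mul => //; exact: W2_coord.
have bnd j : rintegrable rho (fun z => f z.1 * z.1 j 0 * (g z.2 * z.2 j 0)).
  apply: (@le_rintegrable _ _ _ rho _ (fun z : E * E => `|z.1 j 0 * z.2 j 0|)).
  - apply: measurable_funM; apply: measurable_funM.
    + exact: (measurableT_comp mf measurable_fst).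
    + by case: (icoord1 j).
    + exact: (measurableT_comp mg measurable_snd).
    + by case: (icoord2 j).
  - by move=> z; rewrite mulrACA normrM ler_piMl.
  - by apply: integrable_norm => //; exact: sqintegrable_mul.
have hE z : h z * dot z.1 z.2 =
    dot z.1 z.2 + \sum_(j < n) f z.1 * z.1 j 0 * (g z.2 * z.2 j 0).
  rewrite mulrDl mul1r /dot mulr_sumr; congr (_ + _).
  by apply: eq_bigr => j _; rewrite mulrACA.
under eq_Rintegral do rewrite hE.
rewrite Rintegral_add//; last exact: rintegrable_sum.
congr (_ + _).
  rewrite Rintegral_sum; last by move=> j; exact: sqintegrable_mul.
  apply: eq_bigr => j _; rewrite !mxE.
  rewrite (@product_Rintegral _ _ _ _ _ _ _ (fun x : E => x j 0) (fun x : E => x j 0))//.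
  - exact: (sqintegrable_mul (icoord1 j) (icoord2 j)).
  - exact: sqintegrable_rintegrable (W2_coord j sigma2).
  - exact: sqintegrable_rintegrable (W2_coord j eta2).
rewrite Rintegral_sum//.
transitivity (\sum_(j < n) (\int[sigma]_x (f x * x j 0)) * (\int[eta]_y (g y * y j 0))).
  apply: eq_bigr => j _.
  rewrite (@product_Rintegral _ _ _ _ _ _ _ (fun x : E => f x * x j 0)
    (fun y : E => g y * y j 0))//.
  exact: (bnd j).
transitivity (\int[sigma]_x (\sum_(j < n)
    (\int[eta]_y (g y * y j 0)) * (f x * x j 0))).
  rewrite Rintegral_sum; last by move=> j; exact: rintegrableZ.
  by apply: eq_bigr => j _; rewrite Rintegral_scale// mulrC.
apply: eq_Rintegral => x _; rewrite /dot mulr_sumr; apply: eq_bigr => j _.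
rewrite mxE mulrC -mulrA; congr (_ * (_ * _)).
by apply: eq_Rintegral => y _; rewrite mxE.
Qed.

End perturbation.

(** If y_i were not almost surely constant, g = [above_dev] of y_i would give w_i > 0, hence w <> 0.
    With f = [above_dev] of x.w the gain cannot be positive, so x.w is almost surely constant and
    sigma charges a hyperplane. *)
Lemma covmax_le0_degenerate i : covmax sigma eta <= 0 ->
  eta [set y | y i 0 <> mean eta i 0] = 0%E.
Proof.
move=> c0; have iZ := W2_coord i eta2.
have -> : mean eta i 0 = \int[eta]_y y i 0 by rewrite mxE.
apply: above_dev_cov => //; rewrite leNgt; apply/negP => gpos.
pose g := above_dev eta (fun y => y i 0).
pose w := vmean eta (fun y => g y *: y).
have wi : 0 < w i 0.
  by rewrite mxE; under eq_Rintegral do rewrite mxE.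
have w0 : w != 0 by apply: contraTneq wi => ->; rewrite mxE ltxx.
have iw := W2_dot w sigma2.
pose f := above_dev sigma (fun x => dot x w).
have corr := perturbed_correlation (measurable_above_dev iw) (measurable_above_dev iZ)
  (above_dev_le1 iw) (above_dev_le1 iZ) (Rintegral_above_dev iw) (Rintegral_above_dev iZ).
have le0 : \int[sigma]_x (f x * dot x w) <= 0.
  have := ub_le_sup (correlations_ubound sigma2 eta2) corr.
  move: c0; rewrite /covmax -/g -/w -/f; lra.
have := above_dev_cov iw le0; set z0 := \int[sigma]_x dot x w => ne0.
have mD : measurable [set x : E | dot x w = z0].
  rewrite -[X in measurable X]setTI.
  by have [mw _] := iw; exact: (mw measurableT [set z0] (measurable_set1 _)).
have : (sigma setT = 0)%E.
  have -> : [set: E] = [set x | dot x w = z0] `|` ~` [set x | dot x w = z0].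
    by rewrite setUv.
  rewrite measureU//; last 2 first.
  - exact: measurableC.
  - by rewrite setICr.
  by rewrite [X in (X + _)%E](hyperplane0 z0 w0) add0e; exact: ne0.
by rewrite probability_setT => /eqP; rewrite onee_eq0.
Qed.

End degenerate_target.

(** * Slices *)

Definition pack_mfun {d d'} {T : measurableType d} (T' : measurableType d')
  {f : T -> T'} (mf : measurable_fun setT f) : {mfun T >-> T'} :=
  mfun_Sub (mem_set mf).

Section slices.
Context {R : realType} {n : nat}.
Variables (sigma mu : probability 'cV[R]_n R).
Hypotheses (sigma2 : W2_space sigma) (mu2 : W2_space mu).
Hypothesis hyperplane0 : forall (theta : 'cV[R]_n) r, theta != 0 ->
  sigma [set x | dot x theta = r] = 0%E.
Local Notation E := ('cV[R]_n).

Definition slice_map (theta x : E) : R :=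
  ot_map_1d (slice sigma theta) (slice mu theta) (dot x theta).

Lemma measurable_dotr (theta : E) : measurable_fun setT (fun x : E => dot x theta).
Proof. by apply: measurable_dot => //; exact: measurable_cst. Qed.

Section direction.
Variable theta : E.
Hypothesis theta0 : theta != 0.

Let X : {RV sigma >-> R} := mfun_Sub (mem_set (measurable_dotr theta)).
Let Y : {RV mu >-> R} := mfun_Sub (mem_set (measurable_dotr theta)).

Let atomless r : sigma (X @^-1` [set r]) = 0%E.
Proof. exact: hyperplane0. Qed.

Let slice_mapE : slice_map theta = rearrangement X Y.
Proof. by []. Qed.

Lemma measurable_slice_map : measurable_fun setT (slice_map theta).
Proof. by rewrite slice_mapE; exact: measurable_rearrangement. Qed.

Lemma slice_map_law (A : set (measurableTypeR R)) : measurable A ->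
  sigma (slice_map theta @^-1` A) = slice mu theta A.
Proof. by rewrite slice_mapE; exact: rearrangement_law. Qed.

Let lawT : is_law sigma (slice_map theta) (distribution mu Y).
Proof. by split; [exact: measurable_slice_map|exact: slice_map_law]. Qed.

Let lawY : is_law mu (fun y => dot y theta) (distribution mu Y).
Proof. by split => //; exact: measurable_dotr. Qed.

Local Notation RR := (measurableTypeR R).

Let id_sqintegrable : sqintegrable (distribution mu Y) id.
Proof. by apply: (sqintegrable_law lawY) => //; exact: W2_dot. Qed.

Lemma slice_map_sqintegrable : sqintegrable sigma (slice_map theta).
Proof. exact: (law_sqintegrable lawT id_sqintegrable). Qed.

Lemma slice_map_mean : \int[sigma]_x slice_map theta x = dot (mean mu) theta.
Proof.
have i := sqintegrable_rintegrable id_sqintegrable.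
by rewrite -(law_Rintegral lawT i) (law_Rintegral lawY i) W2_mean_dot.
Qed.

Lemma slice_map_mom2 :
  \int[sigma]_x slice_map theta x ^+ 2 = \int[mu]_y dot y theta ^+ 2.
Proof.
have [_ i] := id_sqintegrable.
by rewrite -(law_Rintegral lawT i) (law_Rintegral lawY i).
Qed.

(** Stated for any pair of variables with the two slices as laws, so that it covers couplings on the
    line as well as projections of couplings on R^n. *)
Lemma slice_map_optimal d (T : measurableType d) (P : probability T R)
    (X1 Y1 : T -> R) : sqintegrable P X1 -> sqintegrable P Y1 ->
  (forall A : set (measurableTypeR R), measurable A ->
    P (X1 @^-1` A) = slice sigma theta A) ->
  (forall A : set (measurableTypeR R), measurable A ->
    P (Y1 @^-1` A) = slice mu theta A) ->
  \int[P]_t (X1 t * Y1 t) <= \int[sigma]_x (dot x theta * slice_map theta x).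
Proof.
move=> iX iY eX eY; apply: comonotone_le => //.
- exact: W2_dot.
- exact: slice_map_sqintegrable.
- by move=> A /upper_measurable mA; rewrite eX.
- by move=> A /upper_measurable mA; rewrite eY// slice_map_law.
- move=> A B uA uB; exact: (@rearrangement_nested _ _ _ _ _ _ _ X Y).
Qed.

Lemma slice_map_cost : \int[sigma]_x (dot x theta - slice_map theta x) ^+ 2 =
  \int[sigma]_x dot x theta ^+ 2 + \int[mu]_y dot y theta ^+ 2 -
  2 * \int[sigma]_x (dot x theta * slice_map theta x).
Proof.
have iX := W2_dot theta sigma2; have iT := slice_map_sqintegrable.
have [_ iX2] := iX; have [_ iT2] := iT; have iXT := sqintegrable_mul iX iT.
rewrite -slice_map_mom2 -Rintegral_scale// -Rintegral_add// -Rintegral_sub//.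
- by apply: eq_Rintegral => x _; ring.
- exact: rintegrableD.
- exact: rintegrableZ.
Qed.

(** With fixed marginals the cost depends on the correlation alone; the law of (x.theta, slice map
    of x) is a coupling with the largest one. *)
Lemma W2_1d_slice : W2_1d (slice sigma theta) (slice mu theta) =
  (Num.sqrt (\int[sigma]_x (dot x theta - slice_map theta x) ^+ 2))%:E.
Proof.
have iX := W2_dot theta sigma2; have iT := slice_map_sqintegrable.
have mX := measurable_dotr theta; have mT := measurable_slice_map.
have msub : measurable_fun setT (fun z : RR * RR => `|z.1 - z.2|).
  by apply: measurableT_comp => //; exact: measurable_funB.
(* The projections are restated with values in [measurableTypeR R], the type over which [slice] and
   [W2_1d] are formulated. *)
have mXR : measurable_fun (U := RR) setT (fun x : E => dot x theta) by [].
have mYR : measurable_fun (U := RR) setT (fun y : E => dot y theta) by [].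
pose XR : {RV sigma >-> RR} := @pack_mfun _ _ E RR _ mXR.
pose YR : {RV mu >-> RR} := @pack_mfun _ _ E RR _ mYR.
have lawXR : @is_law _ E _ RR R sigma (fun x => dot x theta) (distribution sigma XR) by [].
have lawYR : @is_law _ E _ RR R mu (fun y => dot y theta) (distribution mu YR) by [].
have mid : measurable_fun setT (fun r : RR => r : R) by [].
have iXR : sqintegrable (distribution sigma XR) (fun r : RR => r : R).
  exact: (sqintegrable_law lawXR).
have iYR : sqintegrable (distribution mu YR) (fun r : RR => r : R).
  by apply: (sqintegrable_law lawYR) => //; exact: W2_dot.
have mpair : measurable_fun (U := (RR * RR)%type) setT
    (fun x : E => (dot x theta, slice_map theta x)).
  by apply/measurable_fun_pairP; split.
pose F : {RV sigma >-> (RR * RR)%type} := @pack_mfun _ _ E (RR * RR)%type _ mpair.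
have cF : couplings (slice sigma theta) (slice mu theta) (distribution sigma F).
  by move=> A mA; split => //; rewrite -slice_map_law.
have cost (gamma : probability (RR * RR)%type R) :
    couplings (slice sigma theta) (slice mu theta) gamma ->
    [/\ sqintegrable gamma (fun z => `|z.1 - z.2|),
    \int[gamma]_z `|z.1 - z.2| ^+ 2 =
      \int[sigma]_x dot x theta ^+ 2 + \int[mu]_y dot y theta ^+ 2 -
      2 * \int[gamma]_z (z.1 * z.2) &
    sqintegrable gamma (fun z : RR * RR => z.1 : R) /\
    sqintegrable gamma (fun z : RR * RR => z.2 : R)].
  move=> c.
  have law1 : is_law gamma fst (distribution sigma XR) by split => // A /c[].
  have law2 : is_law gamma snd (distribution mu YR) by split => // A /c[].
  have i1 := law_sqintegrable law1 iXR; have i2 := law_sqintegrable law2 iYR.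
  have [_ i12] := i1; have [_ i22] := i2.
  have i3 := sqintegrable_mul i1 i2.
  have i4 := sqintegrableB i1 i2.
  split => //.
    by apply: le_sqintegrable i4 => // z; rewrite normr_id.
  have [_ iX2] := iXR; have [_ iY2] := iYR.
  rewrite -(law_Rintegral lawXR iX2) (law_Rintegral law1 iX2).
  rewrite -(law_Rintegral lawYR iY2) (law_Rintegral law2 iY2).
  rewrite -Rintegral_scale// -Rintegral_add// -Rintegral_sub//.
  - by apply: eq_Rintegral => z _; rewrite real_normK ?num_real//; ring.
  - exact: rintegrableD.
  - exact: rintegrableZ.
have norm gamma : couplings (slice sigma theta) (slice mu theta) gamma ->
    ('N[gamma]_2%:E [(fun z : RR * RR => `|z.1 - z.2|%:E)] =
     (Num.sqrt (\int[gamma]_z `|z.1 - z.2| ^+ 2))%:E)%E.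
  by move=> /cost[i _ _]; rewrite (@Lnorm2E _ _ _ gamma (fun z => `|z.1 - z.2|)).
rewrite slice_map_cost; apply/eqP; rewrite eq_le; apply/andP; split.
  apply: ereal_inf_lbound; exists (distribution sigma F) => //.
  rewrite norm//; have [_ -> [i1 i2]] := cost _ cF.
  have lawF : is_law sigma F (distribution sigma F) by [].
  by rewrite (law_Rintegral lawF (sqintegrable_mul i1 i2)).
apply: le_ereal_inf_tmp => _ [gamma c <-].
rewrite norm//; have [_ -> [i1 i2]] := cost _ c.
rewrite lee_fin ler_wsqrtr// lerB// ler_pM2l//.
by apply: slice_map_optimal => // A mA; have [] := c A mA.
Qed.

End direction.
End slices.

(** * Measurability of the slice cost in the direction *)

Section joint_measurability.
Context {R : realType} {n : nat}.
Variables (sigma mu : probability 'cV[R]_n R).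
Hypotheses (sigma2 : W2_space sigma) (mu2 : W2_space mu).
Hypothesis hyperplane0 : forall (theta : 'cV[R]_n) r, theta != 0 ->
  sigma [set x | dot x theta = r] = 0%E.
Local Notation E := ('cV[R]_n).

Let X (theta : E) : {RV sigma >-> R} := mfun_Sub (mem_set (measurable_dotr theta)).
Let Y (theta : E) : {RV mu >-> R} := mfun_Sub (mem_set (measurable_dotr theta)).

(** A function of direction and point together, as Tonelli requires for a cost measurable in the
    direction. *)
Definition slice_map0 (z : E * E) : R := rearrangement0 (X z.1) (Y z.1) z.2.

Let p (z : E * E) := cdf (X z.1) (dot z.2 z.1).
Let q (y : R) (z : E * E) := cdf (Y z.1) y.

Let mle d (T : measurableType d) (f g : T -> R) : measurable_fun setT f ->
  measurable_fun setT g -> measurable [set t | f t <= g t].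
Proof.
move=> mf mg; rewrite -[X in measurable X]setTI.
exact: (measurable_fun_ler mf mg measurableT).
Qed.

Let msection d (T : measurableType d) (nu : probability E R) (A : set (T * E)) :
  measurable A -> measurable_fun setT (fun t => nu [set x | A (t, x)]).
Proof.
move=> mA; have := @indic_measurable_fun_fubini_tonelli_F _ _ T E R nu A mA.
congr measurable_fun; apply/funext => t.
transitivity (\int[nu]_x (\1_[set x | A (t, x)] x)%:E)%E; first by [].
rewrite integral_indic ?setIT//.
by have := measurable_xsection t mA; congr measurable; apply/seteqP; split => x;
  rewrite /xsection /= inE.
Qed.

(** The cdf at a projected point is the sigma-measure of a section of a measurable set in three
    vector variables. *)
Let mp : measurable_fun setT p.
Proof.
apply: (@msection _ _ sigma [set w : (E * E) * E | dot w.2 w.1.1 <= dot w.1.2 w.1.1]).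
by apply: mle; apply: measurable_dot => //; exact: measurableT_comp.
Qed.

Let mq y : measurable_fun setT (q y).
Proof.
apply: (@msection _ _ mu [set w : (E * E) * E | dot w.2 w.1.1 <= y]).
by apply: mle => //; apply: measurable_dot => //; exact: measurableT_comp.
Qed.

(** Off N the value exceeds y exactly when the cdf of the mu-slice at y is below p, so only
    measurability of the two cdfs is used, never that of the quantile. *)
Lemma measurable_slice_map0 : measurable_fun setT slice_map0.
Proof.
move=> mT; apply: (measurability _ (RGenOInfty.measurableE R)) => // _ [_ [y ->] <-].
pose N := [set z | (p z <= 0)%E] `|` [set z | (1 <= p z)%E].
have mN : measurable N.
  apply: measurableU; rewrite -[X in measurable X]setTI.
    exact: emeasurable_fun_infty_c.
  exact: emeasurable_fun_c_infty.
have NE z : N z <-> cdf_extreme (X z.1) z.2.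
  rewrite /cdf_extreme /N /= negb_and -!leNgt.
  by split => [[]->|/orP[]]; rewrite ?orbT//; [left|right].
have -> : setT `&` slice_map0 @^-1` `]y, +oo[ =
    (~` N `&` [set z | (q y z < p z)%E]) `|` (N `&` [set _ | y < 0]).
  rewrite setTI; apply/seteqP; split => z /=; rewrite in_itv/= andbT.
    move=> yz; have [Nz|nNz] := pselect (N z); [right|left]; split=> //; move: yz.
      by have /negPf Ez := proj1 (NE z) Nz; rewrite /slice_map0 /rearrangement0 Ez.
    have nE : ~ cdf_extreme (X z.1) z.2 by move=> /NE.
    by rewrite /slice_map0 rearrangement0E// !ltNge rearrangement_le.
  move=> [[nNz]|[/NE/negPf Nz]].
    have nE : ~ cdf_extreme (X z.1) z.2 by move=> /NE.
    by rewrite /slice_map0 rearrangement0E// !ltNge rearrangement_le.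
  by rewrite /slice_map0 /rearrangement0 Nz.
apply: measurableU; apply: measurableI => //; first exact: measurableC.
  rewrite -[X in measurable X]setTI; exact: (measurable_lte measurableT (mq y) mp).
by case: (ltP y 0) => _; [rewrite (_ : [set _ | _] = setT)//|
  rewrite (_ : [set _ | _] = set0)//]; apply/seteqP; split.
Qed.

Definition slice_cost (theta : E) : \bar R :=
  (\int[sigma]_x ((dot x theta - slice_map0 (theta, x)) ^+ 2)%:E)%E.

Lemma measurable_slice_cost : measurable_fun setT slice_cost.
Proof.
apply: (@measurable_fun_fubini_tonelli_F _ _ _ _ _ sigma
  (fun z : E * E => ((dot z.2 z.1 - slice_map0 z) ^+ 2)%:E)).
  apply/measurable_EFinP; apply: measurable_funX; apply: measurable_funB.
    exact: measurable_dot.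
  exact: measurable_slice_map0.
by move=> z; rewrite lee_fin sqr_ge0.
Qed.

(** [slice_map0] and [slice_map] agree off the null set [cdf_extreme]. *)
Lemma slice_costE theta : theta != 0 -> slice_cost theta =
  (\int[sigma]_x (dot x theta - slice_map sigma mu theta x) ^+ 2)%:E.
Proof.
move=> theta0; have iX := W2_dot theta sigma2.
have iT := slice_map_sqintegrable mu2 hyperplane0 theta0.
have [mD iD] := sqintegrableB iX iT.
rewrite -EFin_Rintegral//.
have at0 r : sigma (X theta @^-1` [set r]) = 0%E by exact: hyperplane0.
have mN := measurable_cdf_extreme (X theta).
apply: ae_eq_integral => //.
- apply/measurable_EFinP; apply: measurable_funX; apply: measurable_funB.
    exact: measurable_dotr.
  exact: (@measurable_rearrangement0 _ _ _ _ _ _ _ (X theta) (Y theta)).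
- by apply/measurable_EFinP; exact: measurable_funX.
exists (cdf_extreme (X theta)); split => //; first exact: cdf_extreme0.
move=> x /=; apply: contra_notP => nE _ /=.
by rewrite /slice_map0 /= rearrangement0E.
Qed.

Lemma W2_1d_slice_cost theta : theta != 0 ->
  (W2_1d (slice sigma theta) (slice mu theta) ^+ 2)%E = slice_cost theta.
Proof.
move=> theta0; rewrite slice_costE// W2_1d_slice//.
rewrite -EFin_expe sqr_sqrtr//.
by apply: Rintegral_ge0 => x _; exact: sqr_ge0.
Qed.

End joint_measurability.

(** * Slice matching *)

Section slice_matching_theory.
Context {R : realType} {n : nat}.
Variables (sigma mu : probability 'cV[R]_n R).
Hypotheses (sigma2 : W2_space sigma) (mu2 : W2_space mu).
Hypothesis hyperplane0 : forall (theta : 'cV[R]_n) r, theta != 0 ->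
  sigma [set x | dot x theta = r] = 0%E.
Local Notation E := ('cV[R]_n).

Definition slice_correlation (theta : E) : R :=
  \int[sigma]_x (dot x theta * slice_map sigma mu theta x).

(** The value of c(U), by [covmax_matching], but written through the slices so that its expectation
    can be taken column by column. *)
Definition slice_covariance (Q : 'M[R]_n) : R :=
  \sum_(i < n) slice_correlation (col i Q) - dot (mean sigma) (mean mu).

(** Every coordinate under mu is almost surely its mean, so the slice map is almost everywhere the
    constant r. *)
Lemma slice_correlation_degenerate theta : theta != 0 -> covmax sigma mu <= 0 ->
  slice_correlation theta = dot (mean sigma) theta * dot (mean mu) theta.
Proof.
move=> theta0 c0; pose r := dot (mean mu) theta.
have iX := W2_dot theta sigma2.
have iT := slice_map_sqintegrable mu2 hyperplane0 theta0.
have mr : measurable (~` [set r] : set (measurableTypeR R)).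
  by apply: measurableC; exact: measurable_set1.
have N0 : sigma [set x | slice_map sigma mu theta x <> r] = 0%E.
  transitivity (mu [set y | dot y theta <> r]).
    exact: (slice_map_law mu hyperplane0 theta0 mr).
  have mN : measurable [set y : E | dot y theta <> r].
    rewrite -[X in measurable X]setTI.
    by apply: (measurable_dotr theta measurableT (Y := ~` [set r])).
  apply: (proj1 (negligibleP mu mN)).
  (* The null sets of the finitely many coordinates are combined into one. *)
  have ae : \forall y \ae mu, forall i, (y : E) i 0 = mean mu i 0.
    apply: filter_forall => i.
    have mi : measurable [set y : E | y i 0 <> mean mu i 0].
      rewrite -[X in measurable X]setTI.
      apply: (measurable_mx_entry i 0 measurableT (Y := ~` [set mean mu i 0])).
      by apply: measurableC; exact: measurable_set1.
    apply: (proj2 (negligibleP mu mi)).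
    exact: (covmax_le0_degenerate sigma2 mu2 hyperplane0).
  apply: negligibleS ae => y /=; apply: contra_not => ym.
  by apply: eq_bigr => i _; rewrite ym.
transitivity (\int[sigma]_x (r * dot x theta)).
  apply: (ae_eq_Rintegral (N := [set x | slice_map sigma mu theta x <> r])) => //.
  - by apply: measurable_funM; [case: iX|case: iT].
  - by apply: measurable_funM => //; case: iX.
  - by rewrite -[X in measurable X]setTI; case: iT => mT _; exact: (mT measurableT _ mr).
  - by move=> x /= /contrapT ->; rewrite mulrC.
rewrite Rintegral_scale; last exact: sqintegrable_rintegrable.
by rewrite W2_mean_dot// mulrC.
Qed.

Section frame.
Variables (Q : 'M[R]_n) (oQ : orthogonal_group n Q).

Let theta i := col i Q.
Let theta0 i : theta i != 0.
Proof. by apply: sphere_neq0; exact: col_orthogonal. Qed.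

(** Parseval splits the correlation over the frame, and each projected pair falls under
    [slice_map_optimal]. A general eta with the slices of mu serves both mu itself and the matched
    measure. *)
Lemma correlations_le_slices (eta : probability E R) : W2_space eta ->
  (forall i (A : set (measurableTypeR R)), measurable A ->
     slice eta (theta i) A = slice mu (theta i) A) ->
  sup (correlations sigma eta) <= \sum_(i < n) slice_correlation (theta i).
Proof.
move=> eta2 slices; apply: ge_sup; first exact: correlations_neq0.
move=> _ [pi c <-].
under eq_Rintegral do rewrite (dot_orthogonal _ _ oQ).
have i1 i := coupling_fst_dot sigma2 c (theta i).
have i2 i := coupling_snd_dot eta2 c (theta i).
rewrite Rintegral_sum; last by move=> i; exact: (sqintegrable_mul (i1 i) (i2 i)).
apply: ler_sum => i _.
apply: (slice_map_optimal sigma2 mu2 hyperplane0 (theta0 i) (i1 i) (i2 i)) => A mA.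
  have mA' : measurable ((fun x : E => dot x (theta i)) @^-1` A).
    by rewrite -[X in measurable X]setTI; exact: (measurable_dotr (theta i) measurableT).
  by have [] := c _ mA'.
have mA' : measurable ((fun x : E => dot x (theta i)) @^-1` A).
  by rewrite -[X in measurable X]setTI; exact: (measurable_dotr (theta i) measurableT).
by rewrite -slices//; have [] := c _ mA'.
Qed.

Lemma covmax_le_slices : covmax sigma mu <= slice_covariance Q.
Proof. by rewrite lerD2r; exact: correlations_le_slices. Qed.

(** Each slice correlation is a product of projected means, and Parseval sums these to the term
    being subtracted. *)
Lemma slice_covariance_degenerate : covmax sigma mu <= 0 -> slice_covariance Q = 0.
Proof.
move=> c0; rewrite /slice_covariance (dot_orthogonal _ _ oQ).
apply/eqP; rewrite subr_eq0; apply/eqP; apply: eq_bigr => i _.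
exact: slice_correlation_degenerate (theta0 i) c0.
Qed.

Let T := slice_matching_map sigma mu Q.

Let TE x : T x = \sum_(i < n) slice_map sigma mu (theta i) x *: theta i.
Proof. by []. Qed.

Let mT : measurable_fun setT T.
Proof.
apply: measurable_sum_mx => i; apply: measurable_scale_mx.
  exact: measurable_slice_map.
exact: measurable_cst.
Qed.

Let dotT x i : dot (T x) (theta i) = slice_map sigma mu (theta i) x.
Proof.
have orth j : dot (theta j) (theta i) = (j == i)%:R.
  rewrite dot_coord /theta colE mulmxA oQ mul1mx.
  by rewrite mxE eqxx andbT eq_sym.
have suml m (F : 'I_m -> E) y : dot (\sum_(j < m) F j) y = \sum_(j < m) dot (F j) y.
  elim: m F => [|m IH] F; first by rewrite !big_ord0 dot0l.
  by rewrite !big_ord_recl dotDl IH.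
rewrite TE suml (bigD1 i)//= dotZl orth eqxx mulr1.
by rewrite big1 ?addr0// => j ji; rewrite dotZl orth (negPf ji) mulr0.
Qed.

Definition matching : probability E R := distribution sigma (@pack_mfun _ _ E E _ mT).

Lemma matchingE : matching = slice_matching sigma mu Q :> (set E -> \bar R).
Proof. by []. Qed.

Let lawT : is_law sigma T matching. Proof. by split. Qed.

Let iT i := slice_map_sqintegrable mu2 hyperplane0 (theta0 i).

Lemma matching_W2 : W2_space matching.
Proof.
rewrite /W2_space /second_moment.
rewrite (law_ge0_integral lawT (f := fun y => (enorm y ^+ 2)%:E)).
- have -> : (fun x => (enorm (T x) ^+ 2)%:E) =
      EFin \o (fun x => \sum_(i < n) slice_map sigma mu (theta i) x ^+ 2).
    apply/funext => x /=; rewrite enorm_sqr (dot_orthogonal _ _ oQ).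
    by congr EFin; apply: eq_bigr => i _; rewrite dotT expr2.
  apply: (integrable_lty measurableT); apply: rintegrable_sum => i.
  by case: (iT i).
- by apply/measurable_EFinP; apply: measurable_funX; exact: measurable_enorm.
- by move=> y; rewrite lee_fin sqr_ge0.
Qed.

(** The means are compared along each column, where the component of the matching map is the slice
    map. *)
Lemma mean_matching : mean matching = mean mu.
Proof.
apply/eqP; rewrite -subr_eq0 -dot_eq0 (dot_orthogonal _ _ oQ) big1// => i _.
rewrite -[col i Q]/(theta i) dotBl.
rewrite -(W2_mean_dot _ matching_W2).
rewrite (law_Rintegral lawT (sqintegrable_rintegrable (W2_dot _ matching_W2))).
under eq_Rintegral do rewrite dotT.
by rewrite slice_map_mean// subrr mul0r.
Qed.

Lemma covmax_matching : covmax sigma matching = slice_covariance Q.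
Proof.
rewrite /covmax /slice_covariance mean_matching; congr (_ - _).
apply/eqP; rewrite eq_le; apply/andP; split.
  apply: correlations_le_slices => [|i A mA]; first exact: matching_W2.
  rewrite -(slice_map_law mu hyperplane0 (theta0 i) mA).
  rewrite /slice /pushforward /matching /distribution /pushforward; congr (sigma _).
  by apply/funext => x; exact: (congr1 A (dotT x i)).
apply: ub_le_sup; first exact: correlations_ubound sigma2 matching_W2.
have mpair : measurable_fun setT (fun x : E => (x, T x)).
  by apply/measurable_fun_pairP; split; [exact: measurable_id|exact: mT].
pose pi : probability (E * E)%type R :=
  distribution sigma (@pack_mfun _ _ E (E * E)%type _ mpair).
have cpi : couplings sigma matching pi by [].
exists pi => //.
have lawpi : is_law sigma (fun x => (x, T x)) pi by split.
rewrite (law_Rintegral lawpi (coupling_dot sigma2 matching_W2 cpi)) /=.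
under eq_Rintegral do rewrite (dot_orthogonal _ _ oQ).
under eq_Rintegral do under eq_bigr do rewrite dotT.
rewrite Rintegral_sum// => i; apply: sqintegrable_mul => //; exact: W2_dot.
Qed.

End frame.
End slice_matching_theory.

(** * Random frames *)

Section expected_matching.
Context {R : realType} {n : nat}.
Variables (sigma mu : probability 'cV[R]_n R).
Hypotheses (sigma2 : W2_space sigma) (mu2 : W2_space mu).
Hypothesis hyperplane0 : forall (theta : 'cV[R]_n) r, theta != 0 ->
  sigma [set x | dot x theta = r] = 0%E.
Local Notation E := ('cV[R]_n).
Local Notation c := (covmax sigma mu).
Local Notation V := (var sigma).

(** Zero variance would put sigma on the hyperplane through its mean orthogonal to a basis vector;
    such a vector exists as n > 0. *)
Lemma var_gt0_hyperplane : (0 < n)%N -> 0 < V.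
Proof.
move=> n0; rewrite lt0r var_ge0// andbT; apply/negP => /eqP V0.
pose i0 := Ordinal n0; pose e : E := delta_mx i0 0.
have e0 : e != 0.
  by rewrite -dot_eq0 dot_delta mxE !eqxx oner_eq0.
have iD := sqintegrableB (W2_dot e sigma2) (sqintegrable_cst sigma (dot (mean sigma) e)).
have [mD iD2] := iD.
have iV := W2_centered sigma2.
have le0 : \int[sigma]_x (dot x e - dot (mean sigma) e) ^+ 2 = 0.
  apply/eqP; rewrite eq_le; apply/andP; split; last first.
    by apply: Rintegral_ge0 => x _; exact: sqr_ge0.
  rewrite -V0 varE//; apply: Rintegral_le => // x.
  rewrite -dotBl dot_delta /dot (bigD1 i0)//= -expr2 lerDl.
  by apply: sumr_ge0 => j _; rewrite -expr2 sqr_ge0.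
have abs0 : (\int[sigma]_x `|((dot x e - dot (mean sigma) e) ^+ 2)%:E| = 0)%E.
  transitivity (\int[sigma]_x ((dot x e - dot (mean sigma) e) ^+ 2)%:E)%E.
    by apply: eq_integral => x _; rewrite gee0_abs// lee_fin sqr_ge0.
  by rewrite EFin_Rintegral// le0.
have mf : measurable_fun setT (fun x => ((dot x e - dot (mean sigma) e) ^+ 2)%:E).
  by apply/measurable_EFinP; exact: measurable_funX.
have [N [mN N0 sub]] := proj1 (ae_eq_integral_abs sigma measurableT mf) abs0.
pose H := [set x : E | dot x e = dot (mean sigma) e].
have mH : measurable H.
  rewrite -[X in measurable X]setTI.
  exact: (measurable_dotr e measurableT (measurable_set1 _)).
have cover : setT `<=` N `|` H.
  move=> x _; have [Hx|nHx] := pselect (H x); [by right|left].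
  apply: sub => /= /(_ I) [/eqP]; rewrite sqrf_eq0 subr_eq0 => /eqP; exact: nHx.
have NH : (sigma N + sigma H <= 0)%E.
  by rewrite [X in (_ + X)%E](hyperplane0 _ e0) adde0 [X in (X <= _)%E]N0.
have : (sigma setT <= 0)%E.
  apply: le_trans NH; apply: le_trans (measureU2 sigma mN mH).
  by apply: le_measure; rewrite ?inE//; exact: measurableU.
by rewrite probability_setT leNgt lte01.
Qed.

Hypothesis V0 : 0 < V.

(** For c <= 0 both maps are the default [id] and the coefficient vanishes, so the formula also
    covers the degenerate case. *)
Lemma opt_S_matching (Q : 'M[R]_n) x : orthogonal_group n Q ->
  opt_S sigma (slice_matching sigma mu Q) x = opt_S sigma mu x +
    ((slice_covariance sigma mu Q - c) / V) *: (x - mean sigma).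
Proof.
move=> oQ; have W := matching_W2 mu2 hyperplane0 oQ.
have mE := mean_matching mu2 hyperplane0 oQ.
have cE := covmax_matching sigma2 mu2 hyperplane0 oQ.
have cQ := covmax_le_slices sigma2 mu2 hyperplane0 oQ.
rewrite -(matchingE sigma mu Q).
have [c0|c0] := ltP 0 c.
  rewrite !opt_S_gt0// cE ?mE; last exact: lt_le_trans cQ.
  by rewrite [RHS]addrC addrA -scalerDl -mulrDl subrK.
have Q0 := slice_covariance_degenerate sigma2 mu2 hyperplane0 oQ c0.
rewrite [in LHS]opt_S_le0 ?cE ?Q0// opt_S_le0//.
have -> : c = 0 by apply/eqP; rewrite eq_le c0 covmax_ge0.
by rewrite subrr mul0r scale0r addr0.
Qed.

(** The squared cost of the product coupling: W_2^2 is K - 2c, and the slice costs along a frame sum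
    to K - 2 [slice_covariance]. *)
Let K := mom2 sigma + mom2 mu - 2 * dot (mean sigma) (mean mu).

(** Built on [slice_cost], hence on [slice_map0], because it has to be measurable on the whole
    space. *)
Let g (theta : E) : R := fine (slice_cost sigma mu theta).

Let gE theta : theta != 0 -> slice_cost sigma mu theta = (g theta)%:E.
Proof. by move=> theta0; rewrite /g slice_costE. Qed.

Let g_ge0 theta : 0 <= g theta.
Proof. by apply: fine_ge0; apply: integral_ge0 => x _; rewrite lee_fin sqr_ge0. Qed.

Let mg : measurable_fun setT g.
Proof.
by apply: measurableT_comp => //; exact: measurable_slice_cost.
Qed.

(** By Parseval the second moments of the slices add up to those of sigma and mu in every frame, so
    K does not depend on [Q]. *)
Let sum_g (Q : 'M[R]_n) : orthogonal_group n Q ->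
  \sum_(i < n) g (col i Q) = K - 2 * slice_covariance sigma mu Q.
Proof.
move=> oQ; have theta0 i : col i Q != 0.
  by apply: sphere_neq0; exact: col_orthogonal.
have sq eta : W2_space eta -> mom2 eta = \sum_(i < n) \int[eta]_x dot x (col i Q) ^+ 2.
  move=> h; rewrite -Rintegral_sum; last by move=> i; case: (W2_dot (col i Q) h).
  apply: eq_Rintegral => x _; rewrite (dot_orthogonal _ _ oQ).
  by apply: eq_bigr => i _; rewrite expr2.
rewrite /K /slice_covariance (sq _ sigma2) (sq _ mu2).
under eq_bigr do rewrite /g slice_costE//= slice_map_cost//.
rewrite sumrB big_split -mulr_sumr /= /slice_correlation; ring.
Qed.

Lemma W2_sqr : (W2 sigma mu ^+ 2 = (K - 2 * c)%:E)%E.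
Proof.
rewrite W2E// -EFin_expe sqr_sqrtr; last exact: affine_cost_ge0.
congr EFin; rewrite /affine_cost /K /var scale1r addr0 dotBl !dotBr.
rewrite (dotC (mean mu) (mean sigma)); ring.
Qed.

Section random_frame.
Context d (Omega : measurableType d) (Pr : probability Omega R).
Variables (P : {RV Pr >-> 'M[R]_n}) (u : probability E R).
Hypotheses (P_orthogonal : forall w, orthogonal_group n (P w)).
Hypotheses (P_haar : haar_orthogonal (distribution Pr P)) (u_uniform : uniform_sphere u).

Let lawP i : is_law Pr (fun w => col i (P w)) u.
Proof.
have [_ lawi] := uniform_sphere_col P_haar i u_uniform.
by split; [exact: measurable_col|move=> A mA; rewrite -lawi].
Qed.

(** Each term is at most the sum K - 2 [slice_covariance], which is bounded by the constant K -
    2c. *)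
Let gi i : rintegrable Pr (fun w => g (col i (P w))).
Proof.
have mgi : measurable_fun setT (fun w => g (col i (P w))).
  by apply: (measurableT_comp mg); case: (lawP i).
apply: (@le_rintegrable _ _ _ Pr _ (fun=> K - 2 * c)) => //; last exact: rintegrable_cst.
move=> w; rewrite ger0_norm//.
apply: (@le_trans _ _ (\sum_(j < n) g (col j (P w)))).
  by rewrite (bigD1 i)//= lerDl; apply: sumr_ge0 => j _.
rewrite sum_g// lerD2l lerN2 ler_pM2l//.
exact: covmax_le_slices.
Qed.

Let sum_gi : rintegrable Pr (fun w => \sum_(i < n) g (col i (P w))).
Proof. exact: rintegrable_sum. Qed.

(** A single column carries integrability over to [u]; the index i provides one. *)
Let gu (i : 'I_n) : rintegrable u g.
Proof. by apply: (rintegrable_law (lawP i) mg); exact: gi. Qed.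

(** Measurability of the covariance in the random frame comes from this form, g being measurable. *)
Let covE w : slice_covariance sigma mu (P w) =
  2^-1 * (K - \sum_(i < n) g (col i (P w))).
Proof. by rewrite sum_g//; field. Qed.

Lemma slice_covariance_rintegrable :
  rintegrable Pr (fun w => slice_covariance sigma mu (P w)).
Proof.
under [X in rintegrable _ X]eq_fun do rewrite covE.
by apply: rintegrableZ; apply: rintegrableB => //; exact: rintegrable_cst.
Qed.

Lemma SW2_sqrE : (0 < n)%N -> SW2_sqr u sigma mu = (\int[u]_theta g theta)%:E.
Proof.
move=> n0; have gu0 := gu (Ordinal n0).
have [u1 _] := u_uniform; have mS := @measurable_unit_sphere R n.
rewrite -EFin_Rintegral// (@negligible_integral _ _ _ u setT (~` @unit_sphere R n))//.
- rewrite setTD setCK; apply: eq_integral => theta /set_mem /sphere_neq0 theta0.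
  by rewrite W2_1d_slice_cost// gE.
- exact: measurableC.
- by rewrite [LHS]probability_setC// u1 subee.
Qed.

Lemma expected_slice_covariance : (0 < n)%N ->
  (W2 sigma mu ^+ 2 - n%:R%:E * SW2_sqr u sigma mu =
   (2 * (\int[Pr]_w slice_covariance sigma mu (P w) - c))%:E)%E.
Proof.
move=> n0; rewrite SW2_sqrE// W2_sqr -EFinM -EFinB; congr EFin.
under [X in _ = 2 * (X - _)]eq_Rintegral do rewrite covE.
rewrite Rintegral_scale; last by apply: rintegrableB => //; exact: rintegrable_cst.
rewrite Rintegral_sub//; last exact: rintegrable_cst.
rewrite Rintegral_cst1 Rintegral_sum//.
have -> : \sum_(i < n) \int[Pr]_w g (col i (P w)) = n%:R * \int[u]_theta g theta.
  transitivity (\sum_(i < n) \int[u]_theta g theta).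
    by apply: eq_bigr => i _; rewrite (law_Rintegral (lawP i) (gu i)).
  by rewrite sumr_const card_ord mulr_natl.
by field.
Qed.

End random_frame.
End expected_matching.

Local Open Scope ereal_scope.

Theorem corollary5p5 (R : realType) (n : nat) (n_gt0 : (0 < n)%N)
    (d : measure_display) (Omega : measurableType d) (Pr : probability Omega R)
    (P : {RV Pr >-> 'M[R]_n})
    (P_orthogonal : forall w, orthogonal_group n (P w))
    (P_haar : haar_orthogonal (distribution Pr P))
    (u : probability 'cV[R]_n R) (u_uniform : uniform_sphere u)
    (sigma mu : probability 'cV[R]_n R)
    (sigma_W2ac : W2ac_space sigma) (mu_W2 : W2_space mu) :
  let S_mu := opt_S sigma mu in
  let S_P := fun w => opt_S sigma (slice_matching sigma mu (P w)) in
  let ES_P := fun x => vmean Pr (fun w => S_P w x) in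
  let gap := (W2 sigma mu ^+ 2 - n%:R%:E * SW2_sqr u sigma mu) /
    (2%:E * sqrte (second_moment sigma
                   - (enorm (vmean sigma id) ^+ 2)%:E)) in
  [/\ L2norm sigma (fun x => (S_mu x - ES_P x)%R)
      = \int[Pr]_w L2norm sigma (fun x => (S_mu x - S_P w x)%R),
      \int[Pr]_w L2norm sigma (fun x => (S_mu x - S_P w x)%R) = gap
    & 0 <= gap].
Proof.
move=> S_mu S_P ES_P gap.
have sigma2 : W2_space sigma by case: sigma_W2ac.
have hyperplane0 (theta : 'cV[R]_n) r : theta != 0%R ->
    sigma [set x | dot x theta = r] = 0.
  exact: W2ac_hyperplane.
have V0 := var_gt0_hyperplane sigma2 hyperplane0 n_gt0.
have icov := slice_covariance_rintegrable sigma2 mu_W2 hyperplane0 P_orthogonal P_haar u_uniform.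
pose C w := slice_covariance sigma mu (P w).
pose c := covmax sigma mu.
pose V := var sigma.
pose D := (\int[Pr]_w C w)%R.
have cC w : (c <= C w)%R by exact: covmax_le_slices.
have cD : (c <= D)%R.
  rewrite -[leLHS](Rintegral_cst1 Pr); apply: Rintegral_le => //.
  exact: rintegrable_cst.
have S_PE w x : S_P w x = (S_mu x + ((C w - c) / V) *: (x - mean sigma))%R.
  exact: opt_S_matching.
have ES_PE x : ES_P x = (S_mu x + ((D - c) / V) *: (x - mean sigma))%R.
  (* An opaque name for the difference keeps [mxE] from unfolding its entries. *)
  have [y yE] : exists y, y = (x - mean sigma)%R by exists (x - mean sigma)%R.
  rewrite -yE; apply/colP => i; rewrite [LHS]mxE [RHS]mxE [X in (_ + X)%R]mxE.
  (* Each entry is affine in [C w], so the expectation merely replaces [C w] by [D]. *)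
  transitivity (\int[Pr]_w
      ((S_mu x i 0 - c / V * y i 0) + y i 0 / V * C w))%R.
    apply: eq_Rintegral => w _; rewrite S_PE -yE mxE [X in (_ + X)%R]mxE.
    by field; rewrite gt_eqF.
  rewrite Rintegral_add; [|exact: rintegrable_cst|exact: rintegrableZ].
  rewrite Rintegral_cst1 Rintegral_scale// -/D.
  by field; rewrite gt_eqF.
(* For a >= 0 the norm is linear in a. It is applied with a = C w - c for each frame and with a = D
   - c for the expected map. *)
have norm (a : R) (S : 'cV[R]_n -> 'cV[R]_n) : (0 <= a)%R ->
    (forall x, S x = S_mu x + (a / V) *: (x - mean sigma))%R ->
    L2norm sigma (fun x => (S_mu x - S x)%R) = (a / Num.sqrt V)%:E.
  move=> a0 SE.
  have -> : (fun x => S_mu x - S x)%R = (fun x => - (a / V) *: (x - mean sigma))%R.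
    by apply/funext => x; rewrite SE opprD addrA subrr add0r scaleNr.
  rewrite L2norm_centered// normrN ger0_norm ?divr_ge0// ?ltW//.
  congr EFin; rewrite -/V -[X in (a / X * _)%R](sqr_sqrtr (ltW V0)).
  by field; rewrite gt_eqF// sqrtr_gt0.
have gapE : gap = ((D - c) / Num.sqrt V)%:E.
  rewrite /gap (expected_slice_covariance sigma2 mu_W2 hyperplane0 P_orthogonal P_haar)//.
  rewrite second_momentE// enorm_sqr -EFinB /=.
  (* The quotient in the extended reals is a real one because 2 sqrt V is nonzero. *)
  rewrite -[(mom2 sigma - _)%R]/V -EFinM inver mulf_eq0 pnatr_eq0/= gt_eqF ?sqrtr_gt0//.
  rewrite -EFinM; congr EFin; rewrite -/D -/c.
  by field; rewrite gt_eqF// sqrtr_gt0.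
have normE : \int[Pr]_w L2norm sigma (fun x => (S_mu x - S_P w x)%R) =
    ((D - c) / Num.sqrt V)%:E.
  transitivity (\int[Pr]_w ((Num.sqrt V)^-1 * (C w - c))%:E).
    apply: eq_integral => w _; rewrite (norm (C w - c)%R) ?subr_ge0//.
    by rewrite mulrC.
  have iCc : rintegrable Pr (fun w => C w - c)%R.
    by apply: rintegrableB => //; exact: rintegrable_cst.
  rewrite EFin_Rintegral; last exact: rintegrableZ.
  rewrite Rintegral_scale// Rintegral_sub//; last exact: rintegrable_cst.
  by rewrite Rintegral_cst1 mulrC.
split.
- by rewrite normE (norm (D - c)%R) ?subr_ge0.
- by rewrite normE gapE.
- by rewrite gapE lee_fin divr_ge0 ?subr_ge0 ?sqrtr_ge0.
Qed.
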